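(* There exist absolute constants $K,c_0,c_1>0$ such that the following holds for all integers $1\le d\le n$, all $\delta\in(0,1/2)$ and all $\theta\in\mathbf{R}^d$. Let $$\ell^*:= d \vee \lceil n( \delta \vee \|\theta\|^2) \rceil \wedge n .$$ With probability greater than $1-c_1e^{-c_0d}$, the estimator $\hat\theta(\ell^* )$ satisfies $$ L^2(\hat{\theta}(\ell^* ),\theta)\le K\cdot \begin{cases} \sqrt{\frac{\delta d}{n}} + \frac{d}{n}, & \|\theta\|^2 \leq \sqrt{\frac{\delta d}{n}}\vee \frac{d}{n},\\[4pt] \frac{\delta d/n }{\|\theta\|^2} , & \sqrt{\frac{\delta d}{n}}\vee \frac{d}{n} \leq \|\theta\|^2 \leq \delta \vee \frac{d}{n},\\[4pt] \frac{d}{n}, & \delta \vee \frac{d}{n} \leq \|\theta\|^2. \end{cases} $$ Moreover, $L^2(\hat{\theta}(\ell^* ),\theta)\le K\left(\sqrt{\frac{\delta d}{n}}+\frac{d}{n}\right)$ with probability greater than $1-c_1e^{-c_0 d}$.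
   Context: Model. For $i=1,\dots,n$ one observes $Y_i=\eta_i\theta+\xi_i\in\mathbf{R}^d$, where $\theta\in\mathbf{R}^d$ is unknown, $\eta_1$ is a Rademacher variable, $(\eta_i)$ is a homogeneous Markov chain on $\{-1,1\}$ with $\eta_{i+1}=\eta_i$ with probability $1-\delta$ and $\eta_{i+1}=-\eta_i$ with probability $\delta$, $\delta\in(0,1/2)$, and $\xi_1,\dots,\xi_n$ are i.i.d. isotropic ($\mathbf{E}\,\xi_i\xi_i^\top=\mathbf{I}_d$) $1$-sub-Gaussian vectors, independent of $\eta$. A random vector $\omega\in\mathbf{R}^d$ is $1$-sub-Gaussian if $\mathbf{E}\exp(\langle v,\omega\rangle)\le\exp(\|v\|^2/2)$ for all $v\in\mathbf{R}^d$. Absolute constants do not depend on $n,d,\delta,\theta$ or the noise distribution. Notation. $a\vee b=\max(a,b)$, $a\wedge b=\min(a,b)$, $\|\cdot\|$ is the Euclidean norm, $x_+=\max(x,0)$. The loss is $L(\tilde\theta,\theta)=\min\{\|\tilde\theta-\theta\|,\|\tilde\theta+\theta\|\}$. Estimator. For a number of buckets $\ell\le n$, it is assumed (without loss of generality, in the paper) that $n=k\ell$ with $k$ an integer (in particular for the value of $\ell$ used in the claim). The indices $1,\dots,n$ are divided into $\ell$ consecutive blocks $I_1,\dots,I_\ell$ of length $k$. Set $\tilde Y_i=\frac1k\sum_{j\in I_i}Y_j$, $\bar\eta_i=\frac1k\sum_{j\in I_i}\eta_j$, $\bar\eta=(\bar\eta_1,\dots,\bar\eta_\ell)^\top$, let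 $\tilde Y\in\mathbf{R}^{d\times\ell}$ be the matrix with columns $\tilde Y_i$, and $\hat\Sigma=\frac1\ell\tilde Y\tilde Y^\top$. Let $\lambda_{max}(\hat\Sigma)$ and $v_{max}(\hat\Sigma)$ be its top eigenvalue and a corresponding unit eigenvector. The estimator is $$\hat{\theta}(\ell) = \sqrt{\frac{\ell}{\mathbf{E}\|\bar{\eta}\|^2}\Big(\lambda_{max}(\hat{\Sigma})-\frac{1}{k}\Big)_+}\; v_{max}(\hat{\Sigma}).$$ Convention on the case distinction: where ranges of $\|\theta\|^2$ overlap at endpoints, the first applicable case is used. *)

(* Defs.v *)
From HB Require Import structures.
From mathcomp Require Export all_boot all_order all_algebra.
From mathcomp Require Export all_classical all_reals all_analysis.

Set Implicit Arguments.
Unset Strict Implicit.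
Unset Printing Implicit Defensive.

Import Order.TTheory GRing.Theory Num.Theory.
Import numFieldNormedType.Exports.

Local Open Scope classical_set_scope.
Local Open Scope ring_scope.

Section LinearAlgebra.
Context {R : realType}.

(* The library's norm on matrices is the sup norm, hence this definition. *)
Definition enorm (m : nat) (x : 'cV[R]_m) : R :=
  Num.sqrt (\sum_(i < m) x i 0 ^+ 2).

Definition edot (m : nat) (x y : 'cV[R]_m) : R := \sum_(i < m) x i 0 * y i 0.

Definition loss (m : nat) (t' t : 'cV[R]_m) : R :=
  Num.min (enorm (t' - t)) (enorm (t' + t)).

Definition lambda_max (m : nat) (A : 'M[R]_m) : R :=
  sup [set a | eigenvalue A a].

(* v picks a unit eigenvector for the largest eigenvalue of each symmetric
   matrix; no regularity in the matrix is imposed on the choice. *)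
Definition top_eigenvector_choice (m : nat) (v : 'M[R]_m -> 'cV[R]_m) : Prop :=
  forall A : 'M[R]_m, A^T = A ->
    A *m v A = lambda_max A *: v A /\ enorm (v A) = 1.

End LinearAlgebra.

Section Probability.
Context {disp : measure_display} {T : measurableType disp} {R : realType}.
Variable P : probability T R.

(* The event E may fail to be measurable (an eigenvector need not be chosen
   measurably): its probability is then understood as inner probability.  For
   measurable E this is just p < P E. *)
Definition with_probability_gt (p : R) (E : set T) : Prop :=
  exists A : set T, [/\ measurable A, A `<=` E & (p%:E < P A)%E].

(* Subfamilies are covered by taking B i = setT for the other indices. *)
Definition mutually_independent (I : finType) d' (T' : measurableType d')
    (X : I -> T -> T') : Prop :=
  forall B : I -> set T', (forall i, measurable (B i)) ->
    P [set w | forall i, B i (X i w)] = (\prod_(i : I) P (X i @^-1` B i))%E.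

Definition identically_distributed (I : finType) d' (T' : measurableType d')
    (X : I -> T -> T') : Prop :=
  forall (i j : I) (B : set T'), measurable B ->
    P (X i @^-1` B) = P (X j @^-1` B).

Definition independent d1 d2 (T1 : measurableType d1) (T2 : measurableType d2)
    (X : T -> T1) (Y : T -> T2) : Prop :=
  forall (A : set T1) (B : set T2), measurable A -> measurable B ->
    P (X @^-1` A `&` Y @^-1` B) = (P (X @^-1` A) * P (Y @^-1` B))%E.

Definition isotropic (m : nat) (X : T -> 'cV[R]_m) : Prop :=
  forall a b : 'I_m,
    ('E_P[(fun w => (X w *m (X w)^T) a b)] = ((1%:M : 'M[R]_m) a b)%:E)%E.

Definition subgaussian1 (m : nat) (X : T -> 'cV[R]_m) : Prop :=
  forall v : 'cV[R]_m,
    ('E_P[(fun w => expR (edot v (X w)))] <= (expR (enorm v ^+ 2 / 2))%:E)%E.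

Definition rademacher (X : T -> R) : Prop :=
  P [set w | X w = 1] = (2^-1)%:E /\ P [set w | X w = -1] = (2^-1)%:E.

(* A trajectory is encoded by s : 'I_n -> bool, the state at time i being
   (-1) ^+ s i; times are shifted to start at 0.  The last clause is
   P(eta_j = s_j | eta_0 = s_0, ..., eta_i = s_i) = p(s_i, s_j) for j = i + 1,
   multiplied through by the probability of the conditioning event. *)
Definition symmetric_markov_chain (n : nat) (delta : R) (eta : 'I_n -> T -> R)
    : Prop :=
  [/\ forall i w, eta i w = 1 \/ eta i w = -1,
      forall i : 'I_n, i = 0%N :> nat -> rademacher (eta i) &
      forall (i j : 'I_n) (s : 'I_n -> bool), j = i.+1 :> nat ->
        P [set w | forall l : 'I_n, (l <= j)%N -> eta l w = (-1) ^+ s l] =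
        ((if s j == s i then 1 - delta else delta)%:E *
         P [set w | forall l : 'I_n, (l <= i)%N -> eta l w = ((-1) ^+ s l)%R])%E].

End Probability.

Section Estimator.
Context {R : realType}.

(* The least integer above n (delta \/ ||theta||^2) is nonnegative whenever
   delta is.  For d <= n both bracketings of d \/ x /\ n agree. *)
Definition ell_star (n d : nat) (delta : R) (theta : 'cV[R]_d) : nat :=
  maxn d
    (minn (absz (Num.ceil (n%:R * Num.max delta (enorm theta ^+ 2)))) n).

(* Average over the i-th of ell consecutive blocks of length n %/ ell;
   meaningful when ell divides n. *)
Definition block_mean (n : nat) (x : 'I_n -> R) (ell : nat) (i : 'I_ell) : R :=
  ((n %/ ell)%:R)^-1 * \sum_(j < n | (j %/ (n %/ ell) == i)%N) x j.

Definition Ytilde (n d ell : nat) (Y : 'I_n -> 'cV[R]_d) : 'M[R]_(d, ell) :=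
  \matrix_(a < d, i < ell) block_mean (fun j => Y j a 0) i.

Definition Sigma_hat (n d ell : nat) (Y : 'I_n -> 'cV[R]_d) : 'M[R]_d :=
  (ell%:R)^-1 *: (Ytilde ell Y *m (Ytilde ell Y)^T).

Definition eta_bar (n ell : nat) (eta : 'I_n -> R) : 'cV[R]_ell :=
  \col_(i < ell) block_mean eta i.

(* E2 stands for the deterministic constant E ||eta_bar||^2. *)
Definition theta_hat (n d ell : nat) (E2 : R) (vmax : 'M[R]_d -> 'cV[R]_d)
    (Y : 'I_n -> 'cV[R]_d) : 'cV[R]_d :=
  Num.sqrt (ell%:R / E2 *
    Num.max (lambda_max (Sigma_hat ell Y) - ((n %/ ell)%:R)^-1) 0)
  *: vmax (Sigma_hat ell Y).

Definition minimax_rate (n d : nat) (delta : R) : R :=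
  Num.sqrt (delta * d%:R / n%:R) + d%:R / n%:R.

Definition local_rate (n d : nat) (delta : R) (theta : 'cV[R]_d) : R :=
  if enorm theta ^+ 2 <=
       Num.max (Num.sqrt (delta * d%:R / n%:R)) (d%:R / n%:R)
  then Num.sqrt (delta * d%:R / n%:R) + d%:R / n%:R
  else if enorm theta ^+ 2 <= Num.max delta (d%:R / n%:R)
  then (delta * d%:R / n%:R) / enorm theta ^+ 2
  else d%:R / n%:R.

End Estimator.

Definition mean_sq_eta_bar disp (T : measurableType disp) (R : realType)
    (P : probability T R) (n ell : nat) (eta : 'I_n -> T -> R) : R :=
  fine ('E_P[(fun w => (enorm (eta_bar ell (fun i => eta i w)) ^+ 2)%R)])%E.

(* d.-tuple R carries the product (i.e. Borel) sigma-algebra. *)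
Definition col_of_tuple (R : realType) (d : nat) (x : d.-tuple R) : 'cV[R]_d :=
  \col_(a < d) tnth x a.

(* Main.v *)
Require Import Defs.
From HB Require Import structures.
From mathcomp Require Import all_boot all_order all_algebra.
From mathcomp Require Import all_classical all_reals all_analysis.
From mathcomp Require Import ring lra measurable_realfun.
Import Order.TTheory GRing.Theory Num.Theory.
Import numFieldNormedType.Exports.
Local Open Scope classical_set_scope.
Local Open Scope ring_scope.

(** Writing eta_i, xi_i for the block means of signs and noise, k for the block
    length and s for the mean of the eta_i^2, the matrix Sigma_hat - I/k is the
    spike s theta theta^T plus a symmetric error. A deterministic perturbation
    argument turns a bound eps on the operator norm of the error into
        loss^2 <= 4 |theta|^2 + 2 eps / s   and
        loss^2 <= 20 (eps / s)^2 / |theta|^2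
    ([loss_crude_bound], [loss_gap_bound]); besides the eigenvector equation it
    only uses that the largest eigenvalue dominates all Rayleigh quotients
    ([rayleigh_le_lambda_max]).

    The quadratic form of the error at a vector u with |u| <= 1 has three parts
    ([signal_noise_error_quadratic]):
      - the fluctuation of |eta|^2 / ell around s, times <u, theta>^2;
      - the cross term of signal and noise, for given signs a weighted sum of
        the independent sub-Gaussian variables <u, xi_j>;
      - the fluctuation of the average of the squared noise block means.
    The chain is driven by independent flips, and eta_i^2 depends only on the
    flips strictly inside the i-th block ([flip_law_product],
    [block_energyE]). So the first and the third part are sums of independent
    centred block variables with Gaussian-type exponential moments, for which a
    Bernstein inequality holds ([bernstein_blocks]). With probability
    1 - O(exp(-19 d)) for each u, resp. 1 - O(exp(-d)) for the first part, the
    three parts are at most of order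
        |theta|^2 sqrt(d / ell),   |theta| sqrt(d / n),   sqrt(d ell) / n.
    A union bound over a lattice net with at most exp(18 d) points
    ([card_net], [net_bound]) makes this uniform in u and gives eps.

    As ell >= n delta, blocks are so short that s >= 1/4
    ([mean_sq_eta_bar_itv]), and for the given ell the three orders combine to
    the local rate in each of its regimes ([rate_of_quadratic_error]). When
    ell = n the first part vanishes, which is what allows |theta| >= 1. The
    second claim follows on the same event, since the local rate never exceeds
    the minimax rate ([local_rate_le_minimax_rate]). *)

Set Implicit Arguments.
Unset Strict Implicit.
Unset Printing Implicit Defensive.

(** * Euclidean norm and quadratic forms *)

Section EuclideanGeometry.
Context {R : realType}.
Implicit Types (m : nat) (a : R).

Lemma edotE m (x y : 'cV[R]_m) : edot x y = (x^T *m y) 0 0.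
Proof. by rewrite mxE; apply: eq_bigr => i _; rewrite mxE. Qed.

Lemma edotC m (x y : 'cV[R]_m) : edot x y = edot y x.
Proof. by apply: eq_bigr => i _; rewrite mulrC. Qed.

Lemma edotDr m (x y z : 'cV[R]_m) : edot x (y + z) = edot x y + edot x z.
Proof. by rewrite !edotE mulmxDr mxE. Qed.

Lemma edotDl m (x y z : 'cV[R]_m) : edot (y + z) x = edot y x + edot z x.
Proof. by rewrite -!(edotC x) edotDr. Qed.

Lemma edotZr m a (x y : 'cV[R]_m) : edot x (a *: y) = a * edot x y.
Proof. by rewrite !edotE -scalemxAr mxE. Qed.

Lemma edotZl m a (x y : 'cV[R]_m) : edot (a *: x) y = a * edot x y.
Proof. by rewrite edotC edotZr edotC. Qed.

Lemma edotNr m (x y : 'cV[R]_m) : edot x (- y) = - edot x y.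
Proof. by rewrite -scaleN1r edotZr mulN1r. Qed.

Lemma edotNl m (x y : 'cV[R]_m) : edot (- x) y = - edot x y.
Proof. by rewrite edotC edotNr edotC. Qed.

Lemma edot0l m (x : 'cV[R]_m) : edot 0 x = 0.
Proof. by rewrite -(scale0r x) edotZl mul0r. Qed.

Lemma edot_trmul m n (A : 'M[R]_(m, n)) x y :
  edot (A^T *m x) y = edot x (A *m y).
Proof. by rewrite !edotE trmx_mul trmxK mulmxA. Qed.

Lemma edotxx_ge0 m (x : 'cV[R]_m) : 0 <= edot x x.
Proof. by apply: sumr_ge0 => i _; rewrite -expr2 sqr_ge0. Qed.

Lemma enormE m (x : 'cV[R]_m) : enorm x = Num.sqrt (edot x x).
Proof. by []. Qed.

Lemma enorm_ge0 m (x : 'cV[R]_m) : 0 <= enorm x.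
Proof. exact: sqrtr_ge0. Qed.

Lemma sqr_enorm m (x : 'cV[R]_m) : enorm x ^+ 2 = edot x x.
Proof. by rewrite enormE sqr_sqrtr // edotxx_ge0. Qed.

Lemma enormZ m a (x : 'cV[R]_m) : enorm (a *: x) = `|a| * enorm x.
Proof.
apply/eqP; rewrite -(@eqrXn2 _ 2) ?mulr_ge0 ?enorm_ge0 //.
by rewrite exprMn !sqr_enorm edotZl edotZr mulrA real_normK ?num_real ?expr2.
Qed.

Lemma enormN m (x : 'cV[R]_m) : enorm (- x) = enorm x.
Proof. by rewrite -scaleN1r enormZ normrN normr1 mul1r. Qed.

Lemma edotxx_eq0 m (x : 'cV[R]_m) : edot x x = 0 -> x = 0.
Proof.
move=> /eqP; rewrite psumr_eq0; last by move=> i _; rewrite -expr2 sqr_ge0.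
move=> /allP h; apply/matrixP => i j; rewrite ord1 [RHS]mxE.
have /implyP/(_ isT) := h i (mem_index_enum _).
by rewrite -expr2 sqrf_eq0 => /eqP.
Qed.

Lemma enorm_eq0 m (x : 'cV[R]_m) : enorm x = 0 -> x = 0.
Proof.
by move=> h; apply: edotxx_eq0; rewrite -sqr_enorm h expr0n.
Qed.

(** The polynomial t |-> (x + t y)^T B (x + t y) has no sign change. The form
    may be degenerate, as mu - A is for the largest eigenvalue mu of A. *)
Lemma semidefinite_cauchy_schwarz m (B : 'M[R]_m) (x y : 'cV[R]_m) :
  B^T = B -> (forall z, 0 <= edot z (B *m z)) ->
  edot y (B *m x) ^+ 2 <= edot y (B *m y) * edot x (B *m x).
Proof.
move=> symB psdB.
have q (t : R) : 0 <= edot x (B *m x) + t * (edot y (B *m x) *+ 2)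
    + t ^+ 2 * edot y (B *m y).
  have := psdB (x + t *: y).
  rewrite mulmxDr -scalemxAr !(edotDl, edotDr, edotZl, edotZr).
  have -> : edot x (B *m y) = edot y (B *m x).
    by rewrite -{1}symB -(trmxK B) edotC !trmxK -edot_trmul symB edotC edotC.
  by move=> h; apply: (le_trans h); rewrite le_eqVlt; apply/orP; left; apply/eqP; ring.
set a := edot y (B *m y) in q *; set b := edot y (B *m x) in q *.
set c := edot x (B *m x) in q *.
have a0 : 0 <= a by exact: psdB.
have c0 : 0 <= c by exact: psdB.
move: a0; rewrite le_eqVlt => /orP[/eqP a0|a0].
  rewrite -a0 mul0r; case: (eqVneq b 0) => [->|b0]; first by rewrite expr0n.
  have := q (- (c + 1) / (b *+ 2)).
  rewrite -a0 mulr0 addr0 mulfVK ?mulrn_eq0 //; lra.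
have := q (- b / a).
have -> : c + - b / a * (b *+ 2) + (- b / a) ^+ 2 * a = (a * c - b ^+ 2) / a.
  by field; rewrite gt_eqF.
by rewrite pmulr_lge0 ?invr_gt0 // subr_ge0.
Qed.

Lemma cauchy_schwarz m (x y : 'cV[R]_m) : `|edot x y| <= enorm x * enorm y.
Proof.
rewrite -(@ler_pXn2r _ 2) ?nnegrE ?mulr_ge0 ?enorm_ge0 //.
rewrite real_normK ?num_real // exprMn !sqr_enorm.
have := @semidefinite_cauchy_schwarz m 1%:M y x (trmx1 _ _).
rewrite !mul1mx; apply => z; rewrite mul1mx; exact: edotxx_ge0.
Qed.

Lemma enormD m (x y : 'cV[R]_m) : enorm (x + y) <= enorm x + enorm y.
Proof.
rewrite -(@ler_pXn2r _ 2) ?nnegrE ?addr_ge0 ?enorm_ge0 //.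
rewrite sqr_enorm edotDl !edotDr (edotC y x) sqrrD !sqr_enorm.
have := cauchy_schwarz x y; have := ler_norm (edot x y); lra.
Qed.

(** Cauchy-Schwarz in each row; the constant is the Frobenius norm. *)
Lemma mulmx_enorm_bounded m n (A : 'M[R]_(m, n)) :
  exists2 c, 0 <= c & forall x, enorm (A *m x) <= c * enorm x.
Proof.
exists (Num.sqrt (\sum_i enorm (row i A)^T ^+ 2)); first exact: sqrtr_ge0.
move=> x; rewrite -(@ler_pXn2r _ 2) ?nnegrE ?mulr_ge0 ?sqrtr_ge0 ?enorm_ge0 //.
rewrite exprMn sqr_enorm sqr_sqrtr; last first.
  by apply: sumr_ge0 => i _; rewrite sqr_ge0.
rewrite mulr_suml; apply: ler_sum => i _.
have -> : (A *m x) i 0 = edot (row i A)^T x.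
  rewrite edotE trmxK -row_mul.
  by rewrite [RHS]mxE.
rewrite -expr2 -exprMn -real_normK ?num_real //.
by rewrite ler_pXn2r ?nnegrE ?mulr_ge0 ?enorm_ge0 ?cauchy_schwarz.
Qed.

End EuclideanGeometry.

(** * The largest eigenvalue of a symmetric matrix *)

Section TopEigenvalue.
Context {R : realType}.

Section PositiveDimension.
Variables (m : nat) (A : 'M[R]_m.+1).
Hypothesis symA : A^T = A.

Let rayleigh := [set r | exists2 x : 'cV[R]_m.+1,
  enorm x = 1 & r = edot x (A *m x)].

Lemma rayleigh_has_sup : has_sup rayleigh.
Proof.
split.
  pose e : 'cV[R]_m.+1 := delta_mx 0 0.
  exists (edot e (A *m e)), e => //.
  rewrite enormE edotE trmx_delta mul_delta_mx mxE sqrtr1 //.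
have [c c0 hc] := mulmx_enorm_bounded A.
exists c => _ [x x1 ->].
apply: (le_trans (ler_norm _)); apply: (le_trans (cauchy_schwarz _ _)).
by rewrite x1 mul1r (le_trans (hc x)) // x1 mulr1.
Qed.

Let mu := sup rayleigh.

Lemma rayleigh_le_sup (x : 'cV[R]_m.+1) : edot x (A *m x) <= mu * enorm x ^+ 2.
Proof.
have [/enorm_eq0 ->|x0] := eqVneq (enorm x) 0.
  by rewrite edot0l sqr_enorm edot0l mulr0.
have xp : 0 < enorm x by rewrite lt0r x0 enorm_ge0.
have h : (enorm x)^-1 ^+ 2 * edot x (A *m x) <= mu.
  apply: ub_le_sup; first by case: rayleigh_has_sup.
  exists ((enorm x)^-1 *: x).
    by rewrite enormZ gtr0_norm ?invr_gt0 // mulVf.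
  by rewrite -scalemxAr edotZl edotZr expr2 mulrA.
by rewrite -ler_pdivrMr ?exprn_gt0 // mulrC -exprVn.
Qed.

(** Were mu not an eigenvalue, the semidefinite matrix B = mu - A would be
    invertible; then |x| <= c |B x| and |B x|^2 <= b x^T B x bound x^T B x away
    from 0 on the unit sphere, and mu would not be the supremum. *)
Lemma rayleigh_sup_eigenvalue : eigenvalue A mu.
Proof.
apply: contrapT => /negP; rewrite /eigenvalue negbK => /eqP ker0.
pose B := mu%:M - A.
have symB : B^T = B by rewrite /B linearB /= tr_scalar_mx symA.
have quadB x : edot x (B *m x) = mu * enorm x ^+ 2 - edot x (A *m x).
  by rewrite /B mulmxBl edotDr edotNr mul_scalar_mx edotZr sqr_enorm.
have psdB x : 0 <= edot x (B *m x) by rewrite quadB subr_ge0 rayleigh_le_sup.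
have unitB : B \in unitmx.
  rewrite -row_free_unit -kermx_eq0 -oppr0 -[B]opprB; apply/eqP.
  move: ker0; rewrite /eigenspace => ker0.
  apply/eqP; rewrite oppr0 -submx0; apply/rV_subP => v /sub_kermxP.
  rewrite mulmxN => /eqP; rewrite oppr_eq0 => /eqP h.
  by rewrite -ker0; apply/sub_kermxP.
have [c c0 hc] := mulmx_enorm_bounded (invmx B).
have [b b0 hb] := mulmx_enorm_bounded B.
have lower x : enorm x = 1 -> 1 <= c ^+ 2 * b * edot x (B *m x).
  move=> x1; set y := B *m x.
  have y1 : 1 <= c * enorm y.
    by rewrite -x1 -{1}[x](mulKmx unitB) hc.
  have yp : 0 < enorm y.
    rewrite lt0r enorm_ge0 andbT; apply/eqP => y0.
    by move: y1; rewrite y0 mulr0 ler10.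
  have ycs : enorm y ^+ 2 <= b * edot x y.
    have := semidefinite_cauchy_schwarz x y symB psdB.
    rewrite -/y -sqr_enorm => h.
    have h2 : edot y (B *m y) <= b * enorm y ^+ 2.
      apply: (le_trans (ler_norm _)); apply: (le_trans (cauchy_schwarz _ _)).
      by rewrite expr2 mulrCA ler_wpM2l ?enorm_ge0.
    have {h h2} : (enorm y ^+ 2) ^+ 2 <= b * enorm y ^+ 2 * edot x y.
      by apply: (le_trans h); apply: ler_wpM2r => //; exact: psdB.
    by rewrite (mulrAC b) [X in X <= _]expr2 ler_pM2r ?exprn_gt0.
  apply: (@le_trans _ _ ((c * enorm y) ^+ 2)); first by rewrite exprn_ege1.
  by rewrite exprMn -mulrA ler_wpM2l ?sqr_ge0.
have [[_ [x x1 _]] _] := rayleigh_has_sup.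
have cb0 : 0 < c ^+ 2 * b.
  rewrite lt0r mulr_ge0 ?sqr_ge0 // andbT; apply/eqP => h.
  by have := lower _ x1; rewrite h mul0r ler10.
have : mu <= mu - (c ^+ 2 * b)^-1.
  apply: ge_sup; first by case: rayleigh_has_sup.
  move=> _ [z z1 ->].
  have := lower _ z1; rewrite -ler_pdivrMl // mulr1 quadB z1 expr1n mulr1.
  lra.
by rewrite lerBrDr gerDl leNgt invr_gt0 cb0.
Qed.

Lemma rayleigh_le_lambda_max_succ (x : 'cV[R]_m.+1) :
  edot x (A *m x) <= lambda_max A * enorm x ^+ 2.
Proof.
apply: (le_trans (rayleigh_le_sup x)); apply: ler_wpM2r; first exact: sqr_ge0.
apply: ub_le_sup; last exact: rayleigh_sup_eigenvalue.
exists mu => a /eigenvalueP[v vA v0].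
have vA' : A *m v^T = a *: v^T by rewrite -{1}symA -trmx_mul vA linearZ.
have := rayleigh_le_sup v^T; rewrite vA' edotZr sqr_enorm.
rewrite ler_pM2r // lt0r edotxx_ge0 andbT; apply/eqP => /edotxx_eq0 h.
by move: v0; rewrite -[v]trmxK h trmx0 eqxx.
Qed.

End PositiveDimension.

Lemma rayleigh_le_lambda_max m (A : 'M[R]_m) : A^T = A ->
  forall x : 'cV[R]_m, edot x (A *m x) <= lambda_max A * enorm x ^+ 2.
Proof.
case: m A => [|m] A symA x; last exact: rayleigh_le_lambda_max_succ.
by rewrite sqr_enorm /edot !big_ord0 mulr0.
Qed.

End TopEigenvalue.

(** * Perturbation of a rank-one spike *)

Section SpikePerturbation.
Context {R : realType}.

Lemma sqr_loss_le m (x theta : 'cV[R]_m) :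
  loss x theta ^+ 2 <= enorm (x - theta) ^+ 2 /\
  loss x theta ^+ 2 <= enorm (x + theta) ^+ 2.
Proof.
by split; rewrite ler_pXn2r ?nnegrE /loss ?le_min ?enorm_ge0 //
  ge_min lexx ?orbT.
Qed.

Variables (m : nat) (M : 'M[R]_m) (s eps lam : R) (v : 'cV[R]_m).
Hypotheses (s_gt0 : 0 < s) (Mv : M *m v = lam *: v) (v1 : enorm v = 1).
Hypothesis rayleighM : forall x, edot x (M *m x) <= lam * enorm x ^+ 2.

Let spike_approx (theta : 'cV[R]_m) := forall x y,
  `|edot x (M *m y) - s * edot x theta * edot theta y| <=
  eps * enorm x * enorm y.
Let rho := Num.sqrt (Num.max lam 0 / s).

(** Test the approximation on the pair (v, v). *)
Lemma top_eigenvalue_close theta : spike_approx theta ->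
  `|lam - s * edot theta v ^+ 2| <= eps.
Proof.
move=> /(_ v v); rewrite Mv edotZr -sqr_enorm v1 expr1n !mulr1.
by rewrite (edotC v theta) -mulrA -expr2.
Qed.

(** The squared norm of the estimate is at most |theta|^2 + eps / s. No
    spectral gap is involved, so this serves the regime of small theta. *)
Lemma loss_crude_bound theta : spike_approx theta ->
  loss (rho *: v) theta ^+ 2 <= 4 * enorm theta ^+ 2 + 2 * (eps / s).
Proof.
move=> spike; apply: (le_trans (sqr_loss_le _ _).1).
have eps0 : 0 <= eps by apply: le_trans (top_eigenvalue_close spike).
have rho2 : rho ^+ 2 <= enorm theta ^+ 2 + eps / s.
  rewrite sqr_sqrtr; last by rewrite divr_ge0 ?(ltW s_gt0) // le_max lexx orbT.
  rewrite ler_pdivrMr // mulrDl mulfVK ?gt_eqF // ge_max; apply/andP; split.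
    have := top_eigenvalue_close spike; rewrite ler_norml => /andP[_ h].
    have : edot theta v ^+ 2 <= enorm theta ^+ 2.
      rewrite -real_normK ?num_real // ler_pXn2r ?nnegrE ?enorm_ge0 //.
      by have := cauchy_schwarz theta v; rewrite v1 mulr1.
    rewrite -(ler_pM2r s_gt0); lra.
  by rewrite addr_ge0 // mulr_ge0 ?sqr_ge0 // ltW.
have : enorm (rho *: v - theta) ^+ 2 <= 2 * rho ^+ 2 + 2 * enorm theta ^+ 2.
  have h := edotxx_ge0 (rho *: v + theta).
  have : edot (rho *: v) (rho *: v) = rho ^+ 2.
    by rewrite edotZl edotZr -sqr_enorm v1 expr1n mulr1 expr2.
  move: h; rewrite !sqr_enorm !(edotDl, edotDr, edotNl, edotNr).
  rewrite (edotC theta (rho *: v)); lra.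
lra.
Qed.

(** With w = M v - s <theta, v> theta the eigenvalue equation reads
    rho v - theta = (<theta, v> / rho - 1) theta + w / (s rho),
    and both summands are of order eps / (s |theta|). *)
Lemma eigenvector_close theta :
  spike_approx theta -> 0 <= edot theta v ->
  2 * (eps / s) < enorm theta ^+ 2 ->
  enorm (rho *: v - theta) <= 4 * (eps / s / enorm theta).
Proof.
move=> spike a0; set t := enorm theta; set e := eps / s => big.
have eps0 : 0 <= eps by apply: le_trans (top_eigenvalue_close spike).
have e0 : 0 <= e by rewrite divr_ge0 // ltW.
have t2 : 0 < t ^+ 2 by apply: le_lt_trans big; rewrite mulr_ge0.
have t0 : 0 < t by rewrite lt0r enorm_ge0 andbT; apply: contraTneq t2 => ->; rewrite expr0n ltxx.
have epsE : eps = e * s by rewrite /e mulfVK // gt_eqF.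
have lam_ge : s * (t ^+ 2 - e) <= lam.
  have := spike theta theta; rewrite ler_norml => /andP[h _].
  have := rayleighM theta.
  move: h; rewrite -sqr_enorm -/t epsE => h1 h2.
  rewrite -(ler_pM2r t2); lra.
have lam0 : 0 < lam by apply: lt_le_trans lam_ge; rewrite mulr_gt0 //; lra.
have rho2 : rho ^+ 2 = lam / s.
  by rewrite /rho sqr_sqrtr ?max_l ?divr_ge0 ?(ltW lam0) ?(ltW s_gt0).
have rho2_ge : t ^+ 2 / 2 <= rho ^+ 2.
  rewrite rho2 ler_pdivlMr //.
  apply: le_trans lam_ge; rewrite [leRHS]mulrC ler_pM2r //; lra.
have rho0 : 0 < rho by rewrite sqrtr_gt0 max_l ?(ltW lam0) // divr_gt0.
have lamE : lam = s * rho ^+ 2 by rewrite rho2 mulrC mulfVK // gt_eqF.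
set a := edot theta v in a0 *.
pose w := M *m v - (s * a) *: theta.
have w_le : enorm w <= eps.
  have [->//|w0] := eqVneq (enorm w) 0.
  have wp : 0 < enorm w by rewrite lt0r w0 enorm_ge0.
  rewrite -(ler_pM2r wp) -(expr2 (enorm w)) sqr_enorm {2}/w edotDr edotNr edotZr.
  apply: (le_trans (ler_norm _)); have := spike w v; rewrite v1 mulr1.
  by rewrite -/a -mulrA (mulrC _ a) mulrA.
have aw : `|a ^+ 2 - rho ^+ 2| <= e.
  rewrite -(ler_pM2l s_gt0) -{1}(gtr0_norm s_gt0) -normrM mulrBr -lamE.
  by rewrite distrC mulrC -/e mulrC (mulrC s e) -epsE; apply: top_eigenvalue_close.
have ar : `|a / rho - 1| <= 2 * e / t ^+ 2.
  have -> : a / rho - 1 = (a - rho) / rho by field; rewrite gt_eqF.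
  rewrite normrM normfV (gtr0_norm rho0) ler_pdivrMr //.
  rewrite -(ler_pM2r rho0).
  apply: (@le_trans _ _ e).
    apply: le_trans aw; rewrite subr_sqr normrM ler_wpM2l //.
    by rewrite ger0_norm ?addr_ge0 ?(ltW rho0) // lerDr.
  have -> : 2 * e / t ^+ 2 * rho * rho = 2 * e / t ^+ 2 * rho ^+ 2 by ring.
  have {1}-> : e = 2 * e / t ^+ 2 * (t ^+ 2 / 2) by field; rewrite gt_eqF.
  by rewrite ler_wpM2l // divr_ge0 ?(ltW t2) // mulr_ge0.
have -> : rho *: v - theta = (a / rho - 1) *: theta + (s * rho)^-1 *: w.
  rewrite /w Mv scalerBr !scalerA lamE scalerBl scale1r.
  have -> : (s * rho)^-1 * (s * rho ^+ 2) = rho by field; rewrite !gt_eqF.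
  have -> : (s * rho)^-1 * (s * a) = a / rho by field; rewrite !gt_eqF.
  by rewrite [RHS]addrC addrA subrK.
apply: (le_trans (enormD _ _)); rewrite !enormZ -/t.
have rho_ge : t / 2 <= rho.
  rewrite -(@ler_pXn2r _ 2) ?nnegrE ?(ltW rho0) ?divr_ge0 ?(ltW t0) //.
  apply: le_trans rho2_ge; rewrite exprMn; lra.
have h1 : `|a / rho - 1| * t <= 2 * (e / t).
  apply: (@le_trans _ _ (2 * e / t ^+ 2 * t)); first by rewrite ler_wpM2r // ltW.
  by rewrite le_eqVlt; apply/orP; left; apply/eqP; field; rewrite gt_eqF.
have h2 : `|(s * rho)^-1| * enorm w <= 2 * (e / t).
  rewrite gtr0_norm ?invr_gt0 ?mulr_gt0 // invfM -mulrA.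
  apply: (@le_trans _ _ (s^-1 * (rho^-1 * eps))).
    by rewrite !ler_wpM2l ?invr_ge0 // ltW.
  have -> : s^-1 * (rho^-1 * eps) = e * rho^-1.
    by rewrite epsE; field; rewrite !gt_eqF.
  rewrite mulrCA ler_wpM2l // -[X in X / t]invrK -invfM.
  by rewrite lef_pV2 ?posrE ?mulr_gt0 ?invr_gt0 // mulrC.
lra.
Qed.

(** The regime without a spectral gap is covered by the crude bound. *)
Lemma loss_gap_bound theta : spike_approx theta -> 0 < enorm theta ->
  loss (rho *: v) theta ^+ 2 <= 20 * (eps / s) ^+ 2 / enorm theta ^+ 2.
Proof.
move=> spike t0.
have eps0 : 0 <= eps by apply: le_trans (top_eigenvalue_close spike).
have e0 : 0 <= eps / s by rewrite divr_ge0 // ltW.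
have t2 : 0 < enorm theta ^+ 2 by rewrite exprn_gt0.
have [small|big] := leP (enorm theta ^+ 2) (2 * (eps / s)).
  apply: (le_trans (loss_crude_bound spike)); rewrite ler_pdivlMr //.
  nra.
have sq x : 0 <= x -> x <= 4 * (eps / s / enorm theta) ->
    x ^+ 2 <= 20 * (eps / s) ^+ 2 / enorm theta ^+ 2.
  move=> x0 hx; apply: (@le_trans _ _ ((4 * (eps / s / enorm theta)) ^+ 2)).
    by rewrite ler_pXn2r ?nnegrE // mulr_ge0 // divr_ge0 // ltW.
  rewrite exprMn expr_div_n mulrA ler_pM2r ?invr_gt0 //.
  by rewrite ler_wpM2r ?sqr_ge0 //; lra.
have [a0|a0] := leP 0 (edot theta v).
  apply: (le_trans (sqr_loss_le _ _).1); apply: sq; first exact: enorm_ge0.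
  exact: eigenvector_close.
apply: (le_trans (sqr_loss_le _ _).2); apply: sq; first exact: enorm_ge0.
rewrite -(enormN theta) -{1}(opprK theta); apply: eigenvector_close.
- move=> x y; have := spike x y; rewrite edotNl edotNr; congr (`|_| <= _); ring.
- by rewrite edotNl oppr_ge0 ltW.
- by rewrite enormN.
Qed.

End SpikePerturbation.

(** * A lattice net of the unit ball *)

Section LatticeNet.
Context {R : realType}.
Variable d : nat.
Hypothesis d_gt0 : (0 < d)%N.

(** A sign and a modulus for each coordinate. Encoding 0 with both signs is
    harmless and makes the weighted count a product of geometric series. *)
Definition lattice_code := {ffun 'I_d -> bool * 'I_(16 * d).+1}.

Definition lattice_point (z : lattice_code) : 'cV[R]_d :=
  \col_a ((-1) ^+ (z a).1 * ((z a).2 : nat)%:R / (4 * Num.sqrt d%:R)).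

Definition in_net (z : lattice_code) : bool := enorm (lattice_point z) <= 1.

Let sd_gt0 : 0 < Num.sqrt d%:R :> R. Proof. by rewrite sqrtr_gt0 ltr0n. Qed.

Lemma lattice_step_sqr : (4 * Num.sqrt d%:R) ^+ 2 = (16 * d)%:R :> R.
Proof. by rewrite exprMn sqr_sqrtr ?ler0n // natrM; congr (_ * _); ring. Qed.

Lemma geometric_half_le2 n : \sum_(i < n) (2^-1 : R) ^+ i <= 2.
Proof.
suff -> : \sum_(i < n) (2^-1 : R) ^+ i = 2 - 2 * 2^-1 ^+ n.
  by rewrite gerBl mulr_ge0 // exprn_ge0 // invr_ge0.
elim: n => [|n IH]; first by rewrite big_ord0 expr0; lra.
by rewrite big_ord_recr /= IH exprS; lra.
Qed.

(** Points of the net have integer coordinates m_a with sum |m_a| <= sum m_a^2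
    <= 16 d; counting them with weight 2^(16 d - sum |m_a|) >= 1 factorizes
    over the coordinates. *)
Lemma card_net : \sum_(z : lattice_code | in_net z) (1 : R) <= expR (18 * d%:R).
Proof.
pose wt (z : lattice_code) : R := \prod_a 2^-1 ^+ (z a).2.
have le_wt z : in_net z -> 1 <= 2 ^+ (16 * d) * wt z.
  move=> netz; rewrite /wt -expr_sum exprVn ler_pdivlMr ?exprn_gt0 // mul1r.
  rewrite ler_eXn2l ?ltr1n //.
  apply: (@leq_trans (\sum_a (z a).2 ^ 2)%N).
    by apply: leq_sum => a _; rewrite expnS expn1; case: (nat_of_ord _) => // k; rewrite leq_pmulr.
  rewrite -(ler_nat R) natr_sum -lattice_step_sqr.
  have c0 : 0 < (4 * Num.sqrt d%:R) ^+ 2 :> R by rewrite exprn_gt0 // mulr_gt0.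
  have : enorm (lattice_point z) ^+ 2 <= 1 by rewrite expr_le1 ?enorm_ge0.
  move=> /(ler_wpM2r (ltW c0)); rewrite mul1r sqr_enorm mulr_suml => h.
  apply: le_trans h.
  apply: ler_sum => a _; rewrite !mxE natrX -expr2 -exprMn mulfVK ?gt_eqF ?mulr_gt0 //.
  by rewrite exprMn sqrr_sign mul1r.
apply: (@le_trans _ _ (\sum_(z : lattice_code) 2 ^+ (16 * d) * wt z)).
  rewrite [leRHS](bigID in_net) /= -[leLHS]addr0; apply: lerD.
    exact: ler_sum.
  apply: sumr_ge0 => z _; rewrite mulr_ge0 ?exprn_ge0 //; apply: prodr_ge0 => a _.
  by rewrite exprn_ge0 // invr_ge0.
rewrite -mulr_sumr -(bigA_distr_bigA (fun _ (p : bool * 'I_(16 * d).+1) => 2^-1 ^+ p.2)) /=.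
have -> : 18 * d%:R = (18 * d)%:R :> R by rewrite natrM.
rewrite -[X in expR X]mulr1 expRM_natl.
apply: (@le_trans _ _ (2 ^+ (16 * d) * 4 ^+ d)).
  rewrite ler_wpM2l ?exprn_ge0 // -[X in _ <= _ ^+ X]card_ord -prodr_const.
  apply: ler_prod => a _; apply/andP; split.
    by apply: sumr_ge0 => p _; rewrite exprn_ge0 // invr_ge0.
  rewrite -(pair_bigA _ (fun (b : bool) (m : 'I__) => 2^-1 ^+ m)) /=.
  rewrite big_bool /=; have := geometric_half_le2 (16 * d).+1; lra.
have -> : 4 = 2 ^+ 2 :> R by rewrite expr2; lra.
rewrite -exprM -exprD -mulnDl; apply: lerXn2r; rewrite ?nnegrE ?expR_ge0 //.
by have := expR_ge1Dx (1 : R); lra.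
Qed.

(** Each coordinate is rounded towards 0, so that the norm does not grow. *)
Lemma net_approx (x : 'cV[R]_d) : enorm x <= 1 ->
  exists2 z, in_net z & enorm (x - lattice_point z) <= 1 / 4.
Proof.
move=> x1; set h : R := 4 * Num.sqrt d%:R.
have h0 : 0 < h by rewrite mulr_gt0.
have x_le a : `|x a 0| <= 1.
  rewrite -(@ler_pXn2r _ 2) ?nnegrE // expr1n.
  apply: (@le_trans _ _ (enorm x ^+ 2)); last by rewrite expr_le1 ?enorm_ge0.
  rewrite sqr_enorm /edot (bigD1 a) //= real_normK ?num_real // expr2 lerDl.
  by apply: sumr_ge0 => i _; rewrite -expr2 sqr_ge0.
pose k a := Num.truncn (h * `|x a 0|).
have kP a : (k a)%:R <= h * `|x a 0| < (k a).+1%:R.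
  by apply: truncn_itv; rewrite mulr_ge0 // ltW.
have k_lt a : (k a < (16 * d).+1)%N.
  rewrite ltnS -(ler_nat R); apply: (le_trans (andP (kP a)).1).
  apply: (@le_trans _ _ h); first by rewrite -[leRHS]mulr1 ler_wpM2l // ltW.
  rewrite -lattice_step_sqr -/h expr2 -[leLHS]mulr1 ler_wpM2l ?(ltW h0) //.
  rewrite /h; have : (1 : R) <= Num.sqrt d%:R.
    by rewrite -[leLHS]sqrtr1 ler_sqrt ?ler1n ?ler0n.
  lra.
pose z : lattice_code := [ffun a => (x a 0 < 0, Ordinal (k_lt a))].
have pz a : lattice_point z a 0 = (-1) ^+ (x a 0 < 0)%R * ((k a)%:R / h).
  by rewrite mxE ffunE /= mulrA.
have xE a : x a 0 = (-1) ^+ (x a 0 < 0)%R * `|x a 0|.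
  have [neg|pos] := ltP (x a 0) 0.
    by rewrite expr1 ltr0_norm // mulN1r opprK.
  by rewrite expr0 mul1r ger0_norm.
exists z.
  apply: le_trans x1; rewrite ler_sqrt; last exact: edotxx_ge0.
  apply: ler_sum => a _; rewrite pz exprMn sqrr_sign mul1r -[leRHS]real_normK ?num_real //.
  rewrite ler_pXn2r ?nnegrE ?divr_ge0 ?(ltW h0) //.
  by rewrite ler_pdivrMr // mulrC; case/andP: (kP a).
rewrite -(@ler_pXn2r _ 2) ?nnegrE ?enorm_ge0 ?divr_ge0 //.
rewrite sqr_enorm.
apply: (@le_trans _ _ (\sum_(a < d) (h ^+ 2)^-1)).
  apply: ler_sum => a _; rewrite !mxE -expr2.
  have -> : x a 0 + - ((-1) ^+ (z a).1 * ((z a).2 : nat)%:R / (4 * Num.sqrt d%:R))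
      = (-1) ^+ (x a 0 < 0)%R * (`|x a 0| - (k a)%:R / h).
    by rewrite mulrBr -xE ffunE /= mulrA.
  rewrite exprMn sqrr_sign mul1r -exprVn.
  have /andP[k1 k2] := kP a; rewrite -natr1 in k2.
  have hx : `|x a 0| = h * `|x a 0| / h by rewrite mulrAC mulfV ?mul1r ?gt_eqF.
  rewrite hx -mulrBl exprMn -[leRHS]mul1r; apply: ler_wpM2r.
    by rewrite exprn_ge0 // invr_ge0 ltW.
  by rewrite expr_le1 ?subr_ge0 //; lra.
rewrite sumr_const card_ord lattice_step_sqr natrM -[_ *+ d]mulr_natl.
rewrite invfM mulrCA mulfV ?pnatr_eq0 -?lt0n //; lra.
Qed.

Section QuadraticForm.
Variable E : 'M[R]_d.
Hypothesis symE : E^T = E.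

Let form_sym (x y : 'cV[R]_d) : edot x (E *m y) = edot y (E *m x).
Proof. by rewrite -edot_trmul symE edotC. Qed.

Let unit_values := [set r | exists2 x, enorm x <= 1 & r = `|edot x (E *m x)|].

Let unit_values_sup : has_sup unit_values.
Proof.
split; first by exists `|edot 0 (E *m 0)|, 0; rewrite // enormE edot0l sqrtr0.
have [c c0 hc] := mulmx_enorm_bounded E.
exists c => _ [x x1 ->].
apply: (le_trans (cauchy_schwarz _ _)).
apply: (@le_trans _ _ (1 * (c * 1))); last by rewrite mul1r mulr1.
apply: ler_pM; rewrite ?enorm_ge0 //.
by apply: (le_trans (hc x)); rewrite ler_wpM2l.
Qed.

(** For a symmetric form the numerical radius bounds the bilinear values. *)
Lemma polarization_bound (Q : R) :
  (forall x, enorm x <= 1 -> `|edot x (E *m x)| <= Q) ->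
  forall x y, `|edot x (E *m y)| <= Q * enorm x * enorm y.
Proof.
move=> hQ.
have homog (x : 'cV[R]_d) : enorm x != 0 ->
    exists2 u, enorm u = 1 & x = enorm x *: u.
  move=> x0; exists ((enorm x)^-1 *: x); last by rewrite scalerA mulfV // scale1r.
  by rewrite enormZ ger0_norm ?invr_ge0 ?enorm_ge0 // mulVf.
have quad z : `|edot z (E *m z)| <= Q * edot z z.
  have [/enorm_eq0 ->|/homog[u u1 ->]] := eqVneq (enorm z) 0.
    by rewrite !edot0l normr0 mulr0.
  rewrite -scalemxAr !(edotZl, edotZr) -sqr_enorm u1 expr1n mulr1 !normrM.
  rewrite ger0_norm ?enorm_ge0 // mulrA mulrC ler_wpM2r ?mulr_ge0 ?enorm_ge0 //.
  by apply: hQ; rewrite u1.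
move=> x y.
have [/enorm_eq0 ->|/homog[u u1 ->]] := eqVneq (enorm x) 0.
  by rewrite edot0l normr0 enormE edot0l sqrtr0 mulr0 mul0r.
have [/enorm_eq0 ->|/homog[v v1 ->]] := eqVneq (enorm y) 0.
  by rewrite mulmx0 edotC edot0l normr0 (enormE 0) edot0l sqrtr0 mulr0.
rewrite -scalemxAr edotZl edotZr !enormZ u1 v1 !mulr1 !normrM.
rewrite !(ger0_norm (enorm_ge0 _)).
suff uv : `|edot u (E *m v)| <= Q.
  rewrite mulrA [leLHS]mulrC -mulrA.
  by apply: ler_wpM2r uv; rewrite mulr_ge0 ?enorm_ge0.
have := quad (u + v); have := quad (u - v).
rewrite !mulmxDr !mulmxN !(edotDl, edotDr, edotNl, edotNr) -!sqr_enorm u1 v1.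
rewrite (form_sym v u) (edotC v u) expr1n !ler_norml.
by move=> /andP[h1 h2] /andP[h3 h4]; apply/andP; split; lra.
Qed.

(** With Q the supremum of |x^T E x| on the unit ball and u in the net within
    1/4 of x, the form differs at x and u by (x - u)^T E (x + u), at most Q / 2;
    hence Q <= eta + Q / 2. *)
Lemma net_bound (eta : R) :
  (forall z, in_net z ->
    `|edot (lattice_point z) (E *m lattice_point z)| <= eta) ->
  forall x y, `|edot x (E *m y)| <= 2 * eta * enorm x * enorm y.
Proof.
move=> heta; pose Q := sup unit_values.
have hQ x : enorm x <= 1 -> `|edot x (E *m x)| <= Q.
  by move=> x1; apply: ub_le_sup; [case: unit_values_sup|exists x].
have Q0 : 0 <= Q.
  by apply: le_trans (hQ 0 _); rewrite ?normr_ge0 // enormE edot0l sqrtr0.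
have bil := polarization_bound hQ.
have : Q <= eta + Q / 2.
  apply: ge_sup; first by case: unit_values_sup.
  move=> _ [x x1 ->]; have [z netz xz] := net_approx x1.
  set u := lattice_point z in xz; have u1 : enorm u <= 1 by [].
  have -> : edot x (E *m x) = edot u (E *m u) + edot (x - u) (E *m (x + u)).
    rewrite mulmxDr !(edotDl, edotDr, edotNl) (form_sym u x); ring.
  apply: (le_trans (ler_normD _ _)); apply: lerD; first exact: heta.
  apply: (le_trans (bil _ _)); rewrite -mulrA ler_wpM2l //.
  apply: (@le_trans _ _ (1 / 4 * 2)); last by lra.
  apply: ler_pM; rewrite ?enorm_ge0 //.
  by apply: (le_trans (enormD _ _)); lra.
move=> hQ2; have {}hQ2 : Q <= 2 * eta by lra.
move=> x y; apply: (le_trans (bil x y)).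
by rewrite !ler_wpM2r ?enorm_ge0.
Qed.

End QuadraticForm.
End LatticeNet.

(** * Independence of disjoint groups of coordinates *)

Section ProductLaw.
Context {R : realType} {d' : measure_display} {T' : measurableType d'}.
Variables (n : nat) (mu : probability (n.-tuple T') R).

Definition product_law :=
  mutually_independent mu (fun (i : 'I_n) (x : n.-tuple T') => tnth x i).

Definition depends_on_coords (S : pred 'I_n) (U : Type)
    (F : n.-tuple T' -> U) : Prop :=
  forall x y, (forall j, S j -> tnth x j = tnth y j) -> F x = F y.

Definition box (B : 'I_n -> set T') : set (n.-tuple T') :=
  [set x | forall i, B i (tnth x i)].

Lemma measurable_box B : (forall i, measurable (B i)) -> measurable (box B).
Proof.
move=> mB; rewrite (_ : box B = \big[setI/setT]_(i < n)
    ((fun x : n.-tuple T' => tnth x i) @^-1` B i)).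
  apply: bigsetI_measurable => i _; rewrite -[X in measurable X]setTI.
  by apply: measurable_tnth => //.
rewrite -bigcap_seq; apply/seteqP; split=> x /= h i.
  by move=> _; exact: h.
by apply: h; rewrite /= mem_index_enum.
Qed.

Lemma tuple_measurable_boxes :
  @measurable _ (n.-tuple T') =
  <<s [set A | exists2 B, (forall i, measurable (B i)) & A = box B] >>.
Proof.
apply/seteqP; split.
  apply: smallest_sub; first exact: smallest_sigma_algebra.
  move=> A; rewrite -bigcup_seq => -[i _] [B mB <-].
  apply: sub_sigma_algebra; exists (fun j => if j == i then B else setT).
    by move=> j; case: ifP.
  apply/seteqP; split => [x [_ /= Bx] j|x /(_ i)]; last by rewrite eqxx.
  by case: ifP => // /eqP ->.
apply: smallest_sub; first exact: sigma_algebra_measurable.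
by move=> _ [B mB ->]; exact: measurable_box.
Qed.

Definition merge (S : pred 'I_n) (p : n.-tuple T' * n.-tuple T') :=
  [tuple if S i then tnth p.1 i else tnth p.2 i | i < n].

Lemma measurable_merge S : measurable_fun [set: _] (merge S).
Proof.
apply/measurable_fun_tnthP => i.
rewrite (_ : _ \o _ = fun p => if S i then tnth p.1 i else tnth p.2 i); last first.
  by apply/funext => p /=; rewrite tnth_mktuple.
case: (S i).
  by apply: (measurableT_comp (measurable_tnth i) measurable_fst).
by apply: (measurableT_comp (measurable_tnth i) measurable_snd).
Qed.

HB.instance Definition _ S := isMeasurableFun.Build _ _ _ _ (merge S)
  (measurable_merge S).

Hypothesis mu_prod : product_law.

(** Both laws agree on boxes, which generate. Taking the coordinates in S from
    one sample and the others from an independent copy reduces independence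
    of two groups of coordinates to the theorem of Fubini. *)
Lemma merge_law S A : measurable A ->
  mu A = pushforward (mu \x mu)%E (merge S) A.
Proof.
move=> mA.
apply: (measure_unique
  [set A | exists2 B, (forall i, measurable (B i)) & A = box B] (fun=> setT)
  _ _ _ _ mu (pushforward (mu \x mu)%E (merge S))) => //.
- exact: tuple_measurable_boxes.
- move=> _ _ [B mB ->] [C mC ->]; exists (fun i => B i `&` C i).
    by move=> i; exact: measurableI.
  apply/seteqP; split => [x [h1 h2] i|x h]; first by split.
  by split => i; case: (h i).
- by move=> _; exists (fun=> setT) => //; apply/seteqP; split.
- by rewrite bigcup_const.
- move=> _ [B mB ->].
  pose B1 i := if S i then B i else setT; pose B2 i := if S i then setT else B i.
  have mB1 i : measurable (B1 i) by rewrite /B1; case: ifP.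
  have mB2 i : measurable (B2 i) by rewrite /B2; case: ifP.
  transitivity ((mu \x mu)%E (box B1 `*` box B2)); last first.
    congr (_ _); apply/esym.
    apply/seteqP; split => [[x y] h|[x y] [/= h1 h2] i] /=.
      by split => i /=; have := h i; rewrite /= tnth_mktuple /= /B1 /B2; case: ifP.
    by have := h1 i; have := h2 i; rewrite tnth_mktuple /= /B1 /B2; case: ifP.
  rewrite product_measure1E; [|exact: measurable_box..].
  have boxE C (mC : forall i, measurable (C i)) : mu (box C) = _ := mu_prod mC.
  apply: (eq_trans (boxE B mB)); apply: esym.
  apply: (eq_trans (f_equal2 mule (boxE _ mB1) (boxE _ mB2))); apply: esym.
  rewrite -big_split /=; apply: eq_bigr => i _.
  rewrite /B1 /B2; case: ifP => _.
    by rewrite preimage_setT probability_setT mule1.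
  by rewrite preimage_setT probability_setT mul1e.
- by move=> _; apply: (@le_lt_trans _ _ 1%E); [exact: probability_le1|exact: ltry].
Qed.

Lemma ge0_integral_merge (S : pred 'I_n) (f : n.-tuple T' -> \bar R) :
  measurable_fun [set: n.-tuple T'] f -> (forall x, 0 <= f x)%E ->
  (\int[mu]_x f x = \int[mu \x mu]_p f (merge S p))%E.
Proof.
move=> mf f0; rewrite (eq_measure_integral (pushforward (mu \x mu)%E (merge S))).
  by rewrite ge0_integral_pushforward //; exact: measurable_merge.
by move=> A mA _; exact: merge_law.
Qed.

Lemma integral_merge (S : pred 'I_n) (f : n.-tuple T' -> R) :
  measurable_fun [set: n.-tuple T'] f -> mu.-integrable setT (EFin \o f) ->
  (mu \x mu)%E.-integrable setT (EFin \o (f \o merge S)) /\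
  (\int[mu]_x (f x)%:E = \int[mu \x mu]_p (f (merge S p))%:E)%E.
Proof.
move=> mf intf; have mef : measurable_fun setT (EFin \o f).
  exact/measurable_EFinP.
have int2 : (mu \x mu)%E.-integrable setT (EFin \o (f \o merge S)).
  apply/integrableP; split.
    by apply/measurable_EFinP; apply: measurableT_comp.
  have [_] := integrableP _ _ _ intf.
  rewrite (ge0_integral_merge S) //; last exact: measurableT_comp.
split=> //.
rewrite (eq_measure_integral (pushforward (mu \x mu)%E (merge S))).
  by rewrite integral_pushforward.
by move=> A mA _; exact: merge_law.
Qed.

Section TwoGroups.
Variables (S : pred 'I_n) (F G : n.-tuple T' -> R).
Hypotheses (mF : measurable_fun [set: n.-tuple T'] F)
  (mG : measurable_fun [set: n.-tuple T'] G).
Hypotheses (FS : depends_on_coords S F) (GS : depends_on_coords (predC S) G).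

Let FGmerge p : F (merge S p) * G (merge S p) = F p.1 * G p.2.
Proof.
congr (_ * _); first by apply: FS => j Sj; rewrite tnth_mktuple Sj.
by apply: GS => j /= /negbTE Sj; rewrite tnth_mktuple Sj.
Qed.

Lemma ge0_integral_indep_mul :
  (forall x, 0 <= F x) -> (forall x, 0 <= G x) ->
  (\int[mu]_x (F x * G x)%:E = \int[mu]_x (F x)%:E * \int[mu]_x (G x)%:E)%E.
Proof.
move=> F0 G0; rewrite (ge0_integral_merge S); first last.
- by move=> x; rewrite lee_fin mulr_ge0.
- by apply/measurable_EFinP; exact: measurable_funM.
under eq_integral do rewrite FGmerge.
rewrite (fubini_tonelli1 (fun p => (F p.1 * G p.2)%:E)); first last.
- by move=> x; rewrite lee_fin mulr_ge0.
- apply/measurable_EFinP; apply: measurable_funM.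
    exact: measurableT_comp.
  exact: measurableT_comp.
under eq_integral => x _.
  rewrite /fubini_F /=; under eq_integral do rewrite EFinM.
  rewrite ge0_integralZl //; first last.
  - by rewrite lee_fin.
  - by move=> y _; rewrite lee_fin.
  - exact/measurable_EFinP.
  over.
rewrite ge0_integralZr //.
- exact/measurable_EFinP.
- by move=> y _; rewrite lee_fin.
- by apply: integral_ge0 => y _; rewrite lee_fin.
Qed.

Lemma integral_indep_mul_eq0 :
  mu.-integrable setT (fun x => (F x * G x)%:E) ->
  mu.-integrable setT (EFin \o G) -> (\int[mu]_x (G x)%:E = 0)%E ->
  (\int[mu]_x (F x * G x)%:E = 0)%E.
Proof.
move=> intFG intG G0.
have [int2 ->] := @integral_merge S (fun x => F x * G x) (measurable_funM mF mG) intFG.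
rewrite -integral12_prod_meas1 //; apply: integral0_eq => x _.
rewrite /fubini_F /=; under eq_integral do rewrite FGmerge EFinM.
by apply: (eq_trans (integralZl measurableT intG (F x))); rewrite G0 mule0.
Qed.

End TwoGroups.

(** Induction on the list of blocks: the factors already treated depend on
    coordinates outside the next block. *)
Lemma integral_prod_blocks (I : eqType) (b : 'I_n -> I) (r : seq I)
    (F : I -> n.-tuple T' -> R) :
  uniq r ->
  (forall i, measurable_fun [set: n.-tuple T'] (F i)) ->
  (forall i x, 0 <= F i x) ->
  (forall i, depends_on_coords [pred j | b j == i] (F i)) ->
  (\int[mu]_x (\prod_(i <- r) F i x)%:E =
   \prod_(i <- r) \int[mu]_x (F i x)%:E)%E.
Proof.
move=> ur mF F0 Fdep; elim: r ur => [_|i r IH /= /andP[ir ur]].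
  under eq_integral do rewrite big_nil.
  rewrite big_nil integral_cst // mul1e; exact: probability_setT.
rewrite big_cons -IH //; under eq_integral do rewrite big_cons.
apply: (@ge0_integral_indep_mul [pred j | b j == i]) => //.
- exact: measurable_prod.
- move=> x y xy; rewrite big_seq [RHS]big_seq; apply: eq_bigr => k kr.
  apply: Fdep => j /= /eqP bj; apply: xy => /=; rewrite bj.
  by apply: contraNneq ir => <-.
- by move=> x; apply: prodr_ge0 => k _.
Qed.

End ProductLaw.

(** * Exponential moments and tails *)

Section ExponentialInequalities.
Context {R : realType}.

(** From exp y - 1 <= y exp y, that is 1 - y <= exp (- y), and, for y < 0, from
    1 + y <= exp y. *)
Lemma expR_le_quadratic (y : R) : expR y <= 1 + y + y ^+ 2 * expR `|y|.
Proof.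
have upper (x : R) : expR x - 1 <= x * expR x.
  have := expR_ge1Dx (- x); rewrite -(ler_pM2r (expR_gt0 x)) expRN mulVf; last first.
    by rewrite gt_eqF ?expR_gt0.
  lra.
have [y0|y0] := leP 0 y.
  have h := upper y; rewrite ger0_norm //.
  have : y * (expR y - 1) <= y * (y * expR y) by rewrite ler_wpM2l.
  rewrite expr2; lra.
have h := upper y; have h2 := expR_ge1Dx y.
have e1 : 1 <= expR `|y|.
  by apply: le_trans (expR_ge1Dx _); rewrite lerDl.
have : y * (expR y - 1) <= y * y by rewrite ler_nM2l //; lra.
have : y ^+ 2 * 1 <= y ^+ 2 * expR `|y| by rewrite ler_wpM2l ?sqr_ge0.
rewrite expr2; lra.
Qed.

Lemma expR1_le4 : expR 1 <= 4 :> R.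
Proof.
have h : expR (2^-1 : R) <= 2.
  rewrite -[expR _]invrK -expRN -[leRHS]invrK lef_pV2 ?posrE ?invr_gt0 ?expR_gt0 //.
  by have := expR_ge1Dx (- 2^-1 : R); lra.
have -> : (1 : R) = 2^-1 + 2^-1 by lra.
rewrite expRD; apply: (@le_trans _ _ (2 * 2)); last by lra.
by apply: ler_pM; rewrite ?expR_ge0.
Qed.

Lemma sqr_le_expR (x : R) : 0 <= x -> x ^+ 2 <= 256 * expR (x / 8).
Proof.
move=> x0; have : 1 + x / 16 <= expR (x / 16) := expR_ge1Dx _.
have -> : x / 8 = x / 16 + x / 16 by lra.
rewrite expRD => h.
have : (x / 16) ^+ 2 <= expR (x / 16) ^+ 2.
  by rewrite ler_pXn2r ?nnegrE ?expR_ge0 //; lra.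
rewrite !expr2; lra.
Qed.

Lemma expR_sqr_le_quadratic (lam x : R) : `|lam| <= 1 / 8 -> 0 <= x ->
  expR (lam * x) <= 1 + lam * x + 256 * lam ^+ 2 * expR (x / 4).
Proof.
move=> lam8 x0; apply: (le_trans (expR_le_quadratic _)); rewrite lerD2l.
have e1 : expR `|lam * x| <= expR (x / 8).
  rewrite ler_expR normrM (ger0_norm x0).
  by have := ler_wpM2r x0 lam8; lra.
have -> : x / 4 = x / 8 + x / 8 by lra.
rewrite expRD exprMn.
apply: (@le_trans _ _ (lam ^+ 2 * (256 * expR (x / 8)) * expR (x / 8))); last by lra.
apply: ler_pM => //; rewrite ?expR_ge0 //.
  by rewrite mulr_ge0 // sqr_ge0.
by rewrite ler_wpM2l ?sqr_ge0 // sqr_le_expR.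
Qed.

End ExponentialInequalities.

Section MomentGeneratingFunctions.
Context {R : realType} {dT : measure_display} {T : measurableType dT}.
Variable P : probability T R.
Local Open Scope ereal_scope.

Lemma integral_one : \int[P]_w (1 : \bar R) = 1.
Proof. by rewrite integral_cst // mul1e; exact: probability_setT. Qed.

Lemma measurable_superlevel (X : T -> R) (t : R) :
  measurable_fun setT X -> measurable [set w | (t <= X w)%R].
Proof.
move=> mX; rewrite -[Y in measurable Y]setTI.
rewrite (_ : [set w | (t <= X w)%R] = X @^-1` `[t, +oo[%classic); first exact: mX.
by apply/seteqP; split => w /=; rewrite in_itv /= andbT.
Qed.

Lemma markov_exponential (X : T -> R) (lam B t : R) :
  measurable_fun setT X -> (0 < lam)%R ->
  \int[P]_w (expR (lam * X w))%:E <= B%:E ->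
  P [set w | (t <= X w)%R] <= (B * expR (- (lam * t)))%:E.
Proof.
move=> mX lam0 hB.
pose mm := isMeasurableFun.Build _ _ _ _ _ mX.
pose RX : {RV P >-> R} := HB.pack X mm.
apply: (le_trans (chernoff RX t lam0)).
rewrite EFinM; apply: lee_wpmul2r; first by rewrite lee_fin expR_ge0.
apply: le_trans hB; rewrite /mmt_gen_fun unlock le_eqVlt; apply/orP; left.
by apply/eqP; apply: eq_integral => w _ /=; rewrite mulrC.
Qed.

Lemma two_sided_exponential (X : T -> R) (lam B t : R) :
  measurable_fun setT X -> (0 < lam)%R ->
  \int[P]_w (expR (lam * X w))%:E <= B%:E ->
  \int[P]_w (expR (- lam * X w))%:E <= B%:E ->
  P [set w | (t <= `|X w|)%R] <= (2 * (B * expR (- (lam * t))))%:E.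
Proof.
move=> mX lam0 h1 h2.
have mN : measurable_fun setT (fun w => - X w)%R by exact: measurableT_comp.
have sub : [set w | (t <= `|X w|)%R] `<=`
    [set w | (t <= X w)%R] `|` [set w | (t <= - X w)%R].
  by move=> w /=; rewrite ler_normr => /orP.
apply: (@le_trans _ _ (P ([set w | (t <= X w)%R] `|` [set w | (t <= - X w)%R]))).
  apply: le_measure => //; rewrite inE; last first.
    by apply: measurableU; exact: measurable_superlevel.
  by apply: (@measurable_superlevel (fun w => `|X w|)%R); exact: measurableT_comp.
apply: (le_trans (measureU2 _ _ _)); [exact: measurable_superlevel..|].
rewrite mulr_natl mulr2n EFinD; apply: leeD.
  exact: markov_exponential.
apply: markov_exponential => //.
by under eq_integral do rewrite mulrN -mulNr.
Qed.

(** Integrates a second-order expansion of the exponential whose remainder is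
    dominated by c h. *)
Lemma mgf_le_of_pointwise (X h : T -> R) (lam m c H : R) :
  measurable_fun setT X -> measurable_fun setT h ->
  (forall w, 0 <= h w)%R -> (0 <= c)%R ->
  \int[P]_w (h w)%:E <= H%:E ->
  P.-integrable setT (EFin \o X) -> \int[P]_w (X w)%:E = m%:E ->
  (forall w, expR (lam * X w) <= 1 + lam * X w + c * h w)%R ->
  \int[P]_w (expR (lam * X w))%:E <= (1 + lam * m + c * H)%:E.
Proof.
move=> mX mh h0 c0 hH iX EX hle.
have ih : P.-integrable setT (EFin \o h).
  apply/integrableP; split; first exact/measurable_EFinP.
  under eq_integral do rewrite /= ger0_norm //.
  by apply: (le_lt_trans hH); rewrite ltry.
have i1 : P.-integrable setT (EFin \o cst 1%R).
  by apply/finite_measure_integrable_cst.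
have iXl : P.-integrable setT (fun w => lam%:E * (X w)%:E).
  exact: integrableZl.
have ihc : P.-integrable setT (fun w => c%:E * (h w)%:E).
  exact: integrableZl.
apply: (@le_trans _ _ (\int[P]_w (1 + lam%:E * (X w)%:E + c%:E * (h w)%:E))).
  apply: ge0_le_integral => //.
  - apply/measurable_EFinP; apply: measurableT_comp => //.
    exact: measurable_funM.
  - apply: emeasurable_funD; [apply: emeasurable_funD => //|];
      by apply: measurable_funeM; exact/measurable_EFinP.
  - by move=> w _; rewrite -!EFinM -!EFinD lee_fin.
rewrite integralD //; last exact: integrableD.
rewrite integralD // !integralZl // EX.
rewrite integral_one.
rewrite -EFinM -EFinD [leRHS]EFinD; apply: leeD => //.
by rewrite EFinM; apply: lee_wpmul2l.
Qed.

Lemma mgf_centered_bounded (X : T -> R) (lam : R) :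
  measurable_fun setT X -> (forall w, `|X w| <= 1)%R -> (`|lam| <= 1)%R ->
  \int[P]_w (X w)%:E = 0 ->
  \int[P]_w (expR (lam * X w))%:E <= (expR (4 * lam ^+ 2))%:E.
Proof.
move=> mX X1 lam1 X0.
have iX : P.-integrable setT (EFin \o X).
  apply: (@le_integrable _ _ _ _ _ measurableT _ (EFin \o cst 1%R)).
  - exact/measurable_EFinP.
  - by move=> w _; rewrite /= lee_fin normr1.
  - exact/finite_measure_integrable_cst.
apply: (le_trans (@mgf_le_of_pointwise X (cst 1%R) lam 0%R (4 * lam ^+ 2)%R 1%R
  mX _ _ _ _ iX X0 _)) => //.
- by rewrite mulr_ge0 ?sqr_ge0.
- by rewrite [leLHS]integral_one.
- move=> w; apply: (le_trans (expR_le_quadratic _)); rewrite lerD2l /= mulr1.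
  have lX : (`|lam * X w| <= 1)%R by rewrite normrM mulr_ile1.
  rewrite [leRHS]mulrC; apply: ler_pM; rewrite ?sqr_ge0 ?expR_ge0 //.
    rewrite exprMn -[leRHS]mulr1 ler_wpM2l ?sqr_ge0 //.
    by rewrite -real_normK ?num_real // expr_le1.
  by apply: le_trans expR1_le4; rewrite ler_expR.
by rewrite lee_fin mulr0 addr0 mulr1 expR_ge1Dx.
Qed.

(** Linearization by a Gaussian g: exp(Z^2/4) is the mean of exp(g Z / sqrt 2)
    over g; exchanging the integrals leaves the Gaussian mean of exp(g^2/4),
    which is sqrt 2. *)
Lemma subgaussian_square_mgf (Z : T -> R) :
  measurable_fun setT Z ->
  (forall tau, \int[P]_w (expR (tau * Z w))%:E <= (expR (tau ^+ 2 / 2))%:E) ->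
  \int[P]_w (expR (Z w ^+ 2 / 4))%:E <= 2%:E.
Proof.
move=> mZ sub.
pose r : R := Num.sqrt 2; pose c : R := (r^-1)%R.
have r0 : (0 < r)%R by rewrite sqrtr_gt0.
have r2 : (r ^+ 2 = 2)%R by rewrite sqr_sqrtr.
have c2 : (c ^+ 2 = 2^-1)%R by rewrite exprVn r2.
pose g t := @normal_pdf R 0 1 t.
have gE t : g t = (normal_peak 1 * expR (- t ^+ 2 / 2))%R.
  by rewrite /g normal_pdfE ?oner_neq0 // /normal_fun subr0 expr1n.
have mg : measurable_fun setT g by exact: measurable_normal_pdf.
pose f (p : T * R) := (g p.2 * expR (c * p.2 * Z p.1))%R.
have f0 p : (0 <= f p)%R by rewrite mulr_ge0 ?normal_pdf_ge0 ?expR_ge0.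
have mf : measurable_fun setT (EFin \o f).
  apply/measurable_EFinP; apply: measurable_funM.
    exact: measurableT_comp.
  apply: measurableT_comp => //; apply: measurable_funM.
    exact: measurable_funM.
  exact: measurableT_comp.
apply: (@le_trans _ _ (\int[P]_w \int[lebesgue_measure]_t (f (w, t))%:E));
    last first.
  have f0' p : 0 <= (EFin \o f) p by rewrite lee_fin.
  have FT := @fubini_tonelli _ _ _ _ _ P lebesgue_measure (EFin \o f) mf f0'.
  rewrite /= in FT; rewrite FT.
  apply: (@le_trans _ _ (\int[lebesgue_measure]_t
      (r%:E * (@normal_pdf R 0 r t)%:E))).
    apply: ge0_le_integral => //.
    - move=> t _; apply: integral_ge0 => w _; by rewrite lee_fin f0.
    - exact: (measurable_fun_fubini_tonelli_G (EFin \o f)).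
    - apply: measurable_funeM; apply/measurable_EFinP.
      exact: measurable_normal_pdf.
    move=> t _; rewrite /f /=.
    under eq_integral do rewrite EFinM.
    rewrite ge0_integralZl //; first last.
    - by rewrite lee_fin normal_pdf_ge0.
    - apply/measurable_EFinP; apply: measurableT_comp => //.
      exact: measurable_funM.
    apply: (@le_trans _ _ ((g t)%:E * (expR ((c * t) ^+ 2 / 2))%:E)).
      by apply: lee_wpmul2l; [rewrite lee_fin normal_pdf_ge0|exact: sub].
    rewrite -!EFinM lee_fin gE normal_pdfE ?gt_eqF // /normal_fun subr0 r2.
    rewrite -[leLHS]mulrA -expRD [leRHS]mulrA.
    rewrite /normal_peak r2 expr1n mul1r.
    have -> : (r * (Num.sqrt (2 * pi *+ 2))^-1 = (Num.sqrt (pi *+ 2))^-1 :> R)%R.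
      rewrite -mulrnAr sqrtrM // -/r invfM mulrA mulfV ?mul1r ?gt_eqF //.
    rewrite ler_wpM2l ?invr_ge0 ?sqrtr_ge0 // ler_expR exprMn c2.
    by rewrite le_eqVlt; apply/orP; left; apply/eqP; field.
  rewrite ge0_integralZl //; first last.
  - by rewrite lee_fin ltW.
  - by move=> t _; rewrite lee_fin normal_pdf_ge0.
  - apply/measurable_EFinP; exact: measurable_normal_pdf.
  rewrite integral_normal_pdf mule1 lee_fin.
  rewrite -(@ler_pXn2r _ 2) ?nnegrE ?(ltW r0) // r2; lra.
rewrite le_eqVlt; apply/orP; left; apply/eqP.
apply: eq_integral => w _.
transitivity ((expR (Z w ^+ 2 / 4))%:E *
    \int[lebesgue_measure]_t (@normal_pdf R (c * Z w) 1 t)%:E).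
  by rewrite integral_normal_pdf mule1.
rewrite -ge0_integralZl //; first last.
- by move=> t _; rewrite lee_fin normal_pdf_ge0.
- apply/measurable_EFinP; exact: measurable_normal_pdf.
apply: eq_integral => t _; rewrite -EFinM; congr (_%:E).
rewrite /f /= gE normal_pdfE ?oner_neq0 // /normal_fun expr1n.
rewrite [LHS]mulrCA -[RHS]mulrA; congr (_ * _)%R; rewrite -!expRD; congr expR.
have -> : (Z w ^+ 2 / 4 = (c * Z w) ^+ 2 / 2)%R by rewrite exprMn c2; field.
by field.
Qed.

(** The exponential is expanded to second order; [sqr_le_expR] absorbs the
    remainder into exp(Z^2/4). *)
Lemma mgf_subgaussian_square (Z : T -> R) (sigma2 lam : R) :
  measurable_fun setT Z ->
  (forall tau, \int[P]_w (expR (tau * Z w))%:E <= (expR (tau ^+ 2 / 2))%:E) ->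
  P.-integrable setT (fun w => (Z w ^+ 2)%:E) ->
  \int[P]_w (Z w ^+ 2)%:E = sigma2%:E ->
  (`|lam| <= 1 / 8)%R ->
  \int[P]_w (expR (lam * (Z w ^+ 2 - sigma2)))%:E <= (expR (512 * lam ^+ 2))%:E.
Proof.
move=> mZ sub iZ EZ lam8.
have mZ2 : measurable_fun setT (fun w => Z w ^+ 2)%R by exact: measurable_funX.
have mE (a : R) : measurable_fun setT (fun w => expR (a * Z w ^+ 2))%R.
  by apply: measurableT_comp => //; exact: measurable_funM.
have := @mgf_le_of_pointwise (fun w => Z w ^+ 2)%R (fun w => expR (Z w ^+ 2 / 4))
  lam sigma2 (256 * lam ^+ 2)%R 2%R mZ2 _ _ _ (subgaussian_square_mgf mZ sub) iZ EZ _.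
move=> /(_ _ _ _ _)/wrap[].
- apply: measurableT_comp => //; exact: measurable_funM.
- by move=> w; rewrite expR_ge0.
- by rewrite mulr_ge0 ?sqr_ge0.
- by move=> w; apply: expR_sqr_le_quadratic; rewrite ?sqr_ge0.
move=> h; under eq_integral do rewrite mulrBr expRD mulrC EFinM.
rewrite ge0_integralZl //; last exact/measurable_EFinP.
apply: (@le_trans _ _ ((expR (- (lam * sigma2)))%:E *
    (1 + lam * sigma2 + 256 * lam ^+ 2 * 2)%:E)).
  by apply: lee_wpmul2l => //; rewrite lee_fin expR_ge0.
rewrite -EFinM lee_fin.
apply: (@le_trans _ _ (expR (- (lam * sigma2)) *
    expR (lam * sigma2 + 512 * lam ^+ 2))%R).
  rewrite ler_wpM2l ?expR_ge0 //; apply: le_trans (expR_ge1Dx _).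
  by rewrite -addrA lerD2l lerD2l; lra.
by rewrite -expRD addKr.
Qed.

End MomentGeneratingFunctions.

Section Bernstein.
Context {R : realType} {d' : measure_display} {T' : measurableType d'}.
Variables (n : nat) (mu : probability (n.-tuple T') R).
Hypothesis mu_prod : product_law mu.

(** Choose lam = c0 sqrt(d / ell), at most c0 because d <= ell: the exponential
    moment costs C c0^2 d, the deviation gains c0 B d. *)
Lemma bernstein_blocks (ell d : nat) (b : 'I_n -> 'I_ell)
    (D : 'I_ell -> n.-tuple T' -> R) (c0 C B : R) :
  (0 < d)%N -> (d <= ell)%N -> 0 < c0 ->
  (forall i, measurable_fun [set: n.-tuple T'] (D i)) ->
  (forall i, depends_on_coords [pred j | b j == i] (D i)) ->
  (forall i lam, `|lam| <= c0 ->
    (\int[mu]_x (expR (lam * D i x))%:E <= (expR (C * lam ^+ 2))%:E)%E) ->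
  (mu [set x | (B * Num.sqrt (d%:R * ell%:R) <= `|\sum_i D i x|)%R] <=
    (2 * expR (- ((c0 * B - C * c0 ^+ 2) * d%:R)))%:E)%E.
Proof.
move=> d0 dl c00 mD depD mgfD.
have l0 : 0 < ell%:R :> R by rewrite ltr0n (leq_trans d0).
have dR0 : 0 < d%:R :> R by rewrite ltr0n.
pose q : R := Num.sqrt (d%:R / ell%:R).
have q0 : 0 < q by rewrite sqrtr_gt0 divr_gt0.
have q1 : q <= 1 by rewrite -[leRHS]sqrtr1 ler_sqrt // ler_pdivrMr // mul1r ler_nat.
have q2 : q ^+ 2 = d%:R / ell%:R by rewrite sqr_sqrtr // divr_ge0.
have qs : q * Num.sqrt (d%:R * ell%:R) = d%:R.
  rewrite /q -sqrtrM ?divr_ge0 // mulrACA -expr2.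
  by rewrite mulVf ?gt_eqF // mulr1 sqrtr_sqr ger0_norm.
have total lam : `|lam| = c0 * q ->
    (\int[mu]_x (expR (lam * \sum_i D i x))%:E <=
     (expR (C * c0 ^+ 2 * d%:R))%:E)%E.
  move=> lamE.
  under eq_integral do rewrite mulr_sumr expR_sum.
  rewrite (@integral_prod_blocks _ _ _ _ _ mu_prod _ b _
      (fun i x => expR (lam * D i x))) ?index_enum_uniq //; first last.
  - by move=> i x y xy; rewrite (depD i x y xy).
  - move=> i; apply: measurableT_comp => //; exact: measurable_funM.
  apply: (@le_trans _ _ (\prod_(i < ell) (expR (C * lam ^+ 2))%:E)%E).
    suff: (0 <= \prod_(i < ell) \int[mu]_x (expR (lam * D i x))%:E <=
           \prod_(i < ell) (expR (C * lam ^+ 2))%:E)%E by case/andP.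
    elim/big_ind2: _ => [|x y z t /andP[x0 xy] /andP[z0 zt]|i _].
    - by rewrite lee01 lexx.
    - by rewrite mule_ge0 // lee_pmul.
    - apply/andP; split.
        by apply: integral_ge0 => x _; rewrite lee_fin expR_ge0.
      by apply: mgfD; rewrite lamE -[leRHS]mulr1 ler_wpM2l // ltW.
  rewrite prodEFin lee_fin prodr_const card_ord -expRM_natr ler_expR.
  rewrite -real_normK ?num_real // lamE exprMn q2 !mulrA mulfVK ?gt_eqF //.
have mS : measurable_fun [set: n.-tuple T'] (fun x => \sum_i D i x).
  exact: measurable_sum.
apply: (le_trans (@two_sided_exponential _ _ _ mu (fun x => \sum_i D i x)
  (c0 * q) _ _ mS _ (total _ _) (total _ _))).
- by rewrite mulr_gt0.
- by rewrite gtr0_norm ?mulr_gt0.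
- by rewrite normrN gtr0_norm ?mulr_gt0.
rewrite lee_fin ler_wpM2l // -expRD ler_expR.
rewrite mulrACA qs; lra.
Qed.

End Bernstein.

(** * Independent flips of the sign chain *)

Lemma measure_finite_partition {R : realType} {dT : measure_display}
    {T : measurableType dT} (P : probability T R) (I : finType)
    (A : set T) (F : I -> set T) :
  measurable A -> (forall i, measurable (F i)) ->
  (forall i j w, F i w -> F j w -> i = j) -> (forall w, exists i, F i w) ->
  (P A = \sum_i P (A `&` F i))%E.
Proof.
move=> mA mF Finj Fcov.
have E : A = \bigcup_(i in [set: I]) (A `&` F i).
  apply/seteqP; split => [w Aw|w [i _ []//]].
  by have [i Fi] := Fcov w; exists i.
rewrite {1}E measure_fin_bigcup //; first last.
- by move=> i _; exact: measurableI.
- by move=> i j _ _ [w [[_ Fi] [_ Fj]]]; exact: Finj Fi Fj.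
- exact: finite_finset.
rewrite [RHS](@fsbig_seq _ _ _ _ (index_enum I)) ?index_enum_uniq //.
have -> // : [set: I] = [set` index_enum I].
by apply/seteqP; split => i //= _; rewrite mem_index_enum.
Qed.

Section FlipsOfChain.
Context {R : realType} {dT : measure_display} {T : measurableType dT}.
Variables (P : probability T R) (n : nat) (delta : R).
Variable eta : {RV P >-> n.-tuple R}.
Hypothesis chain : symmetric_markov_chain P delta (fun i w => tnth (eta w) i).

Let eta_ (i : 'I_n) w : R := tnth (eta w) i.

Definition ord_prev (i : 'I_n) : 'I_n :=
  Ordinal (leq_ltn_trans (leq_pred i) (ltn_ord i)).

(** Time 0 keeps the initial state, so that the flips determine the path. *)
Definition flip_tuple (x : n.-tuple R) : n.-tuple R :=
  [tuple if (i : nat) == 0%N then tnth x i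
         else tnth x (ord_prev i) * tnth x i | i < n].

Lemma measurable_flip_tuple :
  measurable_fun [set: n.-tuple R] flip_tuple.
Proof.
apply/measurable_fun_tnthP => i.
rewrite (_ : _ \o _ = fun x : n.-tuple R => if (i : nat) == 0%N then tnth x i
   else tnth x (ord_prev i) * tnth x i); last first.
  by apply/funext => x /=; rewrite tnth_mktuple.
case: eqP => _; first exact: measurable_tnth.
by apply: measurable_funM; exact: measurable_tnth.
Qed.

Definition flips (w : T) : n.-tuple R := flip_tuple (eta w).

Lemma measurable_flips : measurable_fun [set: T] flips.
Proof. by apply: measurableT_comp => //; exact: measurable_flip_tuple. Qed.

HB.instance Definition _ := isMeasurableFun.Build _ _ _ _ flips measurable_flips.

Definition flip_law : probability (n.-tuple R) R := distribution P flips.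

Definition flip_mass (i : 'I_n) (b : bool) : R :=
  if (i : nat) == 0%N then 2^-1 else if b then delta else 1 - delta.

Lemma flip_mass_total i : \sum_b flip_mass i b = 1.
Proof.
by rewrite big_bool /flip_mass; case: eqP => _ /=; lra.
Qed.

Let state (r : 'I_n -> bool) (l : nat) : bool :=
  \big[addb/false]_(k < n | (k <= l)%N) r k.

Let stateS r (i j : 'I_n) : j = i.+1 :> nat -> state r j = r j (+) state r i.
Proof.
move=> ji; rewrite /state (bigD1 j) //=; congr (_ (+) _).
apply: eq_bigl => k; rewrite ji; have [->|kj] := eqVneq k j.
  by rewrite ji leqnn /= ltnn.
rewrite andbT [RHS]leq_eqVlt leq_eqVlt -ji.
move: kj; rewrite -val_eqE /= => /negbTE ->; rewrite ji ltnS /=.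
by rewrite leq_eqVlt.
Qed.

Let state0 r (i : 'I_n) : i = 0%N :> nat -> state r i = r i.
Proof.
move=> i0; rewrite /state (bigD1 i) //= big1 ?addbF // => k /andP[k0 ki].
by move: ki; rewrite -val_eqE /= i0; move: k0; rewrite i0 leqn0 => ->.
Qed.

Let sign_inj (b c : bool) : (-1) ^+ b = (-1) ^+ c :> R -> b = c.
Proof.
by case: b; case: c => //=; rewrite ?expr0 ?expr1 => h; exfalso; move: h; lra.
Qed.

Lemma eta_sqr i w : eta_ i w * eta_ i w = 1.
Proof.
by have [+ _ _] := chain => /(_ i w) [] h; rewrite /eta_ h ?mulr1 ?mulrNN ?mulr1.
Qed.

(** Induction along the chain: the state at time l is the parity of the flips
    up to l, and each new flip contributes one transition factor. *)
Lemma path_probability (r : 'I_n -> bool) (j : nat) : (j < n)%N ->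
  P [set w | forall l : 'I_n, (l <= j)%N -> eta_ l w = (-1) ^+ state r l] =
  (\prod_(l < n | (l <= j)%N) flip_mass l (r l))%:E.
Proof.
have [_ init trans] := chain.
elim: j => [|j IH] jn.
  pose o := Ordinal jn.
  have -> : [set w | forall l : 'I_n, (l <= 0)%N -> eta_ l w = (-1) ^+ state r l]
      = [set w | eta_ o w = (-1) ^+ r o].
    apply/seteqP; split => w /=; first by move=> /(_ o (leqnn _)); rewrite state0.
    move=> h l; rewrite leqn0 => /eqP l0.
    by have -> : l = o by [apply: val_inj]; rewrite state0.
  rewrite (bigD1 o) //= big1 ?mulr1; last first.
    by move=> l /andP[]; rewrite leqn0 -val_eqE /= => ->.
  have [h1 h2] := init o (erefl _).
  by rewrite /flip_mass /=; case: (r o).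
pose i := Ordinal (ltnW jn : (j < n)%N); pose o := Ordinal jn.
rewrite (trans i o (state r) (erefl _)) (IH (ltnW jn)) -EFinM; congr (_%:E).
rewrite [RHS](bigD1 o) //=; congr (_ * _).
  rewrite /flip_mass /= (@stateS r i o) //.
  by case: (r o); case: (state r i).
apply: eq_bigl => l; rewrite -val_eqE /= [(l <= j.+1)%N]leq_eqVlt ltnS.
by case: eqP => [->|_] /=; rewrite ?ltnn ?andbT.
Qed.

Lemma flips_pathE (r : 'I_n -> bool) w :
  (forall l, tnth (flips w) l = (-1) ^+ r l) <->
  (forall l, eta_ l w = (-1) ^+ state r l).
Proof.
have signM (b c : bool) : (-1) ^+ b * (-1) ^+ c = (-1) ^+ (b (+) c) :> R.
  by rewrite signr_addb.
split => [h [l ln]|h l].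
  elim: l ln => [|l IH] ln.
    by have := h (Ordinal ln); rewrite tnth_mktuple (@state0 r (Ordinal ln)).
  have lE : ord_prev (Ordinal ln) = Ordinal (ltnW ln) by apply: val_inj.
  have hl : eta_ (Ordinal (ltnW ln)) w * eta_ (Ordinal ln) w =
      (-1) ^+ r (Ordinal ln).
    by rewrite -h tnth_mktuple /= lE.
  have -> : eta_ (Ordinal ln) w =
      eta_ (Ordinal (ltnW ln)) w * (-1) ^+ r (Ordinal ln).
    by rewrite -hl mulrA eta_sqr mul1r.
  by rewrite (IH (ltnW ln)) signM addbC -(@stateS r (Ordinal (ltnW ln)) (Ordinal ln)).
rewrite tnth_mktuple; case: eqP => [l0|/eqP l0].
  by rewrite -[RHS]/((-1) ^+ r l) -(state0 r l0); exact: h.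
have lE : l = (ord_prev l).+1 :> nat by rewrite /= prednK // lt0n.
rewrite -/(eta_ _ _) -/(eta_ _ _) !h signM (stateS r lE).
by rewrite addbC addbK.
Qed.

Hypothesis n_gt0 : (0 < n)%N.

Lemma flips_mass (r : 'I_n -> bool) :
  P [set w | forall l, tnth (flips w) l = (-1) ^+ r l] =
  (\prod_l flip_mass l (r l))%:E.
Proof.
have lt_n1 : (n.-1 < n)%N by rewrite prednK.
have le_n1 (l : 'I_n) : (l <= n.-1)%N by rewrite -ltnS prednK.
transitivity (P [set w | forall l : 'I_n, (l <= n.-1)%N ->
    eta_ l w = (-1) ^+ state r l]).
  congr (P _); apply/seteqP; split => w /=.
    by move=> /flips_pathE h l _; exact: h.
  by move=> h; apply/flips_pathE => l; exact: h.
rewrite path_probability //; congr (_%:E); apply: eq_bigl => l.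
by rewrite le_n1.
Qed.

(** The flips take finitely many values; the sum over all sign patterns of the
    path weights restricted to the box factorizes over time. *)
Lemma flips_box (B : 'I_n -> set R) : (forall i, measurable (B i)) ->
  P [set w | forall i, B i (tnth (flips w) i)] =
  (\prod_i \sum_(b : bool) (`[< B i ((-1) ^+ b) >]%:R * flip_mass i b))%:E.
Proof.
move=> mB.
have mpre (C : 'I_n -> set R) : (forall i, measurable (C i)) ->
    measurable [set w | forall i, C i (tnth (flips w) i)].
  move=> mC; rewrite -[X in measurable X]setTI.
  exact: (measurable_flips measurableT (measurable_box mC)).
pose F (r : {ffun 'I_n -> bool}) :=
  [set w | forall i, [set (-1) ^+ r i] (tnth (flips w) i)].
rewrite (@measure_finite_partition _ _ _ P _ _ F); first last.
- move=> w; have [pm _ _] := chain.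
  have flip_pm i : exists b : bool, tnth (flips w) i = (-1) ^+ b.
    rewrite tnth_mktuple; case: ifP => _.
      by have [->|->] := pm i w; [exists false|exists true].
    have [->|->] := pm i w; have [->|->] := pm (ord_prev i) w.
    + by exists false; rewrite mulr1.
    + by exists true; rewrite mulr1.
    + by exists true; rewrite mul1r.
    + by exists false; rewrite mulrNN mulr1.
  exists [ffun i => sval (cid (flip_pm i))] => i /=.
  by rewrite ffunE; case: cid.
- move=> r r' w h h'; apply/ffunP => i; apply: sign_inj.
  by rewrite -(h i) -(h' i).
- by move=> r; apply: (mpre (fun i => [set (-1) ^+ r i])) => i; exact: measurable_set1.
- exact: mpre.
rewrite bigA_distr_bigA /= -sumEFin; apply: eq_bigr => r _.
rewrite big_split /= EFinM.
have [Br|nBr] := pselect (forall i, B i ((-1) ^+ r i)).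
  rewrite big1 ?mul1e; last by move=> i _; rewrite asboolT.
  rewrite -flips_mass; congr (P _); apply/seteqP; split => w /=.
    by move=> [_ h] l; exact: h.
  by move=> h; split => i; rewrite h.
have [i nBi] : exists i, ~ B i ((-1) ^+ r i) by exact/existsNP.
rewrite (bigD1 i) //= asboolF // mul0r mul0e.
rewrite (_ : _ `&` _ = set0) ?measure0 //.
by apply/seteqP; split => // w [/= h1 h2]; apply: nBi; rewrite -h2; exact: h1.
Qed.

Lemma flips_coordinate (i : 'I_n) (B : set R) : measurable B ->
  P [set w | B (tnth (flips w) i)] =
  (\sum_(b : bool) (`[< B ((-1) ^+ b) >]%:R * flip_mass i b))%:E.
Proof.
move=> mB; pose C j := if j == i then B else setT.
transitivity (P [set w | forall j, C j (tnth (flips w) j)]).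
  congr (P _); apply/seteqP; split => w /=.
    by move=> Bw j; rewrite /C; case: eqP => // ->.
  by move=> /(_ i); rewrite /C eqxx.
rewrite flips_box; last by move=> j; rewrite /C; case: ifP.
rewrite (bigD1 i) //= /C eqxx [X in _ * X]big1 ?mulr1 // => j /negbTE ->.
rewrite -[RHS](flip_mass_total j); apply: eq_bigr => b _.
by rewrite asboolT // mul1r.
Qed.

Lemma flip_law_product : product_law flip_law.
Proof.
move=> B mB; have E := @flips_box B mB.
transitivity (P [set w | forall i, B i (tnth (flips w) i)]) => //.
rewrite E -prodEFin; apply: eq_bigr => i _.
by rewrite -flips_coordinate.
Qed.

End FlipsOfChain.

(** * Energy of the block means of the chain *)

Section BlockCardinality.
Variables (n ell : nat).
Hypotheses (n_gt0 : (0 < n)%N) (ell_n : (ell %| n)%N).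
Let k := (n %/ ell)%N.

Lemma block_length_gt0 : (0 < k)%N.
Proof. by rewrite divn_gt0 ?(dvdn_gt0 n_gt0) // dvdn_leq. Qed.

Let nE : n = (ell * k)%N. Proof. by rewrite mulnC divnK. Qed.

Lemma block_index_lt (j : 'I_n) : (j %/ k < ell)%N.
Proof. by rewrite ltn_divLR ?block_length_gt0 // -nE. Qed.

Definition block_of (j : 'I_n) : 'I_ell := Ordinal (block_index_lt j).

Lemma card_block (i : 'I_ell) : #|[pred j : 'I_n | (j %/ k == i)%N]| = k.
Proof.
have k0 := block_length_gt0.
have lt (a : 'I_k) : (i * k + a < n)%N.
  rewrite nE; apply: (@leq_trans (i.+1 * k)); last by rewrite leq_mul2r ltn_ord orbT.
  by rewrite mulSn addnC ltn_add2r.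
pose h a := Ordinal (lt a).
have hinj : injective h by move=> a b [] /addnI ab; apply: val_inj.
rewrite -[RHS]card_ord -(card_codom hinj); apply: eq_card => j.
rewrite !inE; apply/idP/codomP => [/eqP ji|[a ->]].
  exists (Ordinal (ltn_pmod j k0)); apply: val_inj => /=.
  by rewrite -ji -divn_eq.
by rewrite /= divnMDl // divn_small ?addn0.
Qed.

Lemma card_block_interior (i : 'I_ell) :
  (#|[pred j : 'I_n | (j %/ k == i)%N && (j %% k != 0)%N]| <= k.-1)%N.
Proof.
have k0 := block_length_gt0.
have lt : (i * k < n)%N by rewrite nE ltn_mul2r k0 ltn_ord.
rewrite -ltnS prednK // -[X in (_ < X)%N](card_block i).
rewrite (cardD1 (Ordinal lt) [pred j : 'I_n | (j %/ k == i)%N]) !inE /= mulnK //.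
rewrite eqxx add1n ltnS; apply: subset_leq_card; apply/fintype.subsetP => j.
rewrite !inE => /andP[ji jk]; rewrite ji andbT; apply: contra jk => /eqP ->.
by rewrite /= modnMl.
Qed.

End BlockCardinality.

Section BlockMean.
Context {R : realType}.
Variables (n ell : nat).
Hypotheses (n_gt0 : (0 < n)%N) (ell_n : (ell %| n)%N).

Lemma sum_block_const (i : 'I_ell) (c : R) :
  \sum_(j < n | (j %/ (n %/ ell) == i)%N) c = c * (n %/ ell)%:R.
Proof. by rewrite sumr_const card_block // mulr_natr. Qed.

Let kR_gt0 : 0 < (n %/ ell)%:R :> R.
Proof. by rewrite ltr0n block_length_gt0. Qed.

Lemma block_mean_const (x : 'I_n -> R) (i : 'I_ell) (c : R) :
  (forall j : 'I_n, (j %/ (n %/ ell) == i)%N -> x j = c) -> block_mean x i = c.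
Proof.
move=> xc; rewrite /block_mean (eq_bigr (fun=> c)) //.
by rewrite sum_block_const mulrCA mulVf ?mulr1 ?gt_eqF.
Qed.

Lemma block_mean_sqr_le1 (x : 'I_n -> R) (i : 'I_ell) :
  (forall j, `|x j| <= 1) -> block_mean x i ^+ 2 <= 1.
Proof.
move=> x1; rewrite -real_normK ?num_real // expr_le1 // /block_mean normrM.
rewrite gtr0_norm ?invr_gt0 // ler_pdivrMl // mulr1.
apply: (le_trans (ler_norm_sum _ _ _)).
rewrite -[leRHS]mul1r -(sum_block_const i); exact: ler_sum.
Qed.

End BlockMean.

Section ChainBlocks.
Context {R : realType} {dT : measure_display} {T : measurableType dT}.
Variables (P : probability T R) (n ell : nat) (delta : R).
Variable eta : {RV P >-> n.-tuple R}.
Hypothesis chain : symmetric_markov_chain P delta (fun i w => tnth (eta w) i).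
Hypotheses (n_gt0 : (0 < n)%N) (ell_n : (ell %| n)%N).

Let eta_ (i : 'I_n) w : R := tnth (eta w) i.
Let k := (n %/ ell)%N.
Let k_gt0 : (0 < k)%N := block_length_gt0 n_gt0 ell_n.

Let eta_pm i w : eta_ i w = 1 \/ eta_ i w = -1.
Proof. by have [h _ _] := chain; exact: h. Qed.

(** The states of a block relative to its first state: the product of the
    flips strictly after the first time of the block. *)
Definition block_path (x : n.-tuple R) (j : 'I_n) : R :=
  \prod_(m < n | [&& (m %/ k == j %/ k)%N, (m %% k != 0)%N & (m <= j)%N]) tnth x m.

Let divk_lt (j : 'I_n) : (j %/ k * k < n)%N.
Proof. exact: leq_ltn_trans (leq_divM _ _) (ltn_ord j). Qed.

Lemma eta_block_path w (j : 'I_n) :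
  eta_ j w = eta_ (Ordinal (divk_lt j)) w * block_path (flips eta w) j.
Proof.
case: j => j jn; elim: j jn => [|j IH] jn.
  rewrite /block_path big_pred0; last first.
    move=> m /=; apply/negbTE/negP => /and3P[_ mk]; rewrite leqn0 => /eqP m0.
    by move: mk; rewrite m0 mod0n.
  by rewrite mulr1; congr eta_; apply: val_inj; rewrite /= div0n.
have [jk0|jk0] := eqVneq (j.+1 %% k)%N 0%N.
  have jE : (j.+1 %/ k * k = j.+1)%N by rewrite [RHS](divn_eq _ k) jk0 addn0.
  rewrite /block_path big_pred0; last first.
    move=> m /=; apply/negbTE/negP => /and3P[/eqP md mk mj].
    have := divn_eq m k; rewrite md jE => mE.
    by move: mj; rewrite mE -[leqRHS]addn0 leq_add2l leqn0 (negbTE mk).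
  by rewrite mulr1; congr eta_; apply: val_inj.
have dE : (j.+1 %/ k = j %/ k)%N.
  rewrite {1}(divn_eq j k) -addnS divnMDl // (@divn_small (j %% k).+1) ?addn0 //.
  rewrite ltn_neqAle ltn_pmod // andbT; apply: contraNneq jk0 => h.
  by rewrite {1}(divn_eq j k) -addnS h -mulSnr modnMl.
have pE : ord_prev (Ordinal jn) = Ordinal (ltnW jn) by apply: val_inj.
have fl : tnth (flips eta w) (Ordinal jn) =
    eta_ (Ordinal (ltnW jn)) w * eta_ (Ordinal jn) w.
  by rewrite tnth_mktuple /= pE.
have -> : eta_ (Ordinal jn) w =
    eta_ (Ordinal (ltnW jn)) w * tnth (flips eta w) (Ordinal jn).
  by rewrite fl mulrA (eta_sqr chain) mul1r.
rewrite (IH (ltnW jn)) -mulrA; congr (_ * _).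
  by congr eta_; apply: val_inj; rewrite /= dE.
rewrite /block_path [RHS](bigD1 (Ordinal jn)) /=; last by rewrite eqxx jk0 leqnn.
rewrite mulrC; congr (_ * _); apply: eq_bigl => m.
rewrite -val_eqE /= dE [(m <= j.+1)%N]leq_eqVlt ltnS.
case: (m =P j.+1 :> nat) => [->|_]; first by rewrite ltnn !andbF.
by rewrite andbT.
Qed.

(** The first state of a block only contributes a sign to the block mean, so
    its square is a function of the flips inside the block. The truncation is
    inactive along the chain and bounds the function on the whole space. *)
Definition block_energy (i : 'I_ell) (x : n.-tuple R) : R :=
  Num.min 1 (block_mean (block_path x) i ^+ 2).

Lemma block_energyE w (i : 'I_ell) :
  block_mean (fun j => eta_ j w) i ^+ 2 = block_energy i (flips eta w).
Proof.
have le1 : block_mean (fun j => eta_ j w) i ^+ 2 <= 1.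
  apply: block_mean_sqr_le1 => // j.
  by have [->|->] := eta_pm j w; rewrite ?normrN normr1.
suff E : block_mean (fun j => eta_ j w) i ^+ 2 =
    block_mean (block_path (flips eta w)) i ^+ 2.
  by rewrite /block_energy -E min_r.
have ik : (i * k < n)%N by rewrite -[X in (_ < X)%N](divnK ell_n) mulnC ltn_mul2l k_gt0 /=.
have -> : block_mean (fun j => eta_ j w) i =
    eta_ (Ordinal ik) w * block_mean (block_path (flips eta w)) i.
  rewrite /block_mean mulrCA; congr (_ * _); rewrite mulr_sumr.
  apply: eq_bigr => j /eqP ji; rewrite eta_block_path; congr (_ * _).
  by congr eta_; apply: val_inj; rewrite /= -ji.
by rewrite exprMn [X in X * _]expr2 (eta_sqr chain) mul1r.
Qed.

Lemma sqr_enorm_eta_bar w :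
  enorm (eta_bar ell (fun i => eta_ i w)) ^+ 2 =
  \sum_i block_energy i (flips eta w).
Proof.
rewrite sqr_enorm; apply: eq_bigr => i _.
by rewrite !mxE -expr2 block_energyE.
Qed.

Lemma block_energy_depends i :
  depends_on_coords [pred j | block_of n_gt0 ell_n j == i] (block_energy i).
Proof.
move=> x y xy; rewrite /block_energy /block_mean; congr (Num.min _ ((_ * _) ^+ 2)).
apply: eq_bigr => j /eqP ji; apply: eq_bigr => m /and3P[/eqP mj _ _].
by apply: xy; rewrite /= -val_eqE /= -/k mj -ji.
Qed.

Lemma measurable_block_energy i :
  measurable_fun [set: n.-tuple R] (block_energy i).
Proof.
apply: measurable_minr => //; apply: measurable_funX; apply: measurable_funM => //.
under eq_fun do rewrite big_mkcond /=.
apply: measurable_sum => j; case: (j %/ _ == i)%N => //.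
rewrite /block_path; under eq_fun do rewrite big_mkcond /=.
apply: measurable_prod => m _; case: [&& _, _ & _] => //.
exact: measurable_tnth.
Qed.

Lemma block_energy_itv i x : 0 <= block_energy i x <= 1.
Proof. by rewrite /block_energy le_min ler01 sqr_ge0 ge_min lexx. Qed.

Definition mean_energy (i : 'I_ell) : R :=
  fine (\int[flip_law eta]_x (block_energy i x)%:E)%E.

Lemma integral_block_energy i :
  (\int[flip_law eta]_x (block_energy i x)%:E = (mean_energy i)%:E)%E.
Proof.
rewrite /mean_energy fineK // ge0_fin_numE; last first.
  by apply: integral_ge0 => x _; rewrite lee_fin; case/andP: (block_energy_itv i x).
apply: (@le_lt_trans _ _ (\int[flip_law eta]_x (1 : \bar R))%E); last first.
  by rewrite integral_one ltry.
apply: ge0_le_integral => //.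
- by move=> x _; rewrite lee_fin; case/andP: (block_energy_itv i x).
- by apply/measurable_EFinP; exact: measurable_block_energy.
- by move=> x _; rewrite lee_fin; case/andP: (block_energy_itv i x).
Qed.

Lemma mean_energy_itv i : 0 <= mean_energy i <= 1.
Proof.
rewrite -!lee_fin -integral_block_energy; apply/andP; split.
  by apply: integral_ge0 => x _; rewrite lee_fin; case/andP: (block_energy_itv i x).
rewrite -(integral_one (flip_law eta)); apply: ge0_le_integral => //.
- by move=> x _; rewrite lee_fin; case/andP: (block_energy_itv i x).
- by apply/measurable_EFinP; exact: measurable_block_energy.
- by move=> x _; rewrite lee_fin; case/andP: (block_energy_itv i x).
Qed.

Lemma mean_sq_eta_barE :
  mean_sq_eta_bar P ell eta_ = \sum_i mean_energy i.
Proof.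
rewrite /mean_sq_eta_bar unlock.
have -> : (\int[P]_w (enorm (eta_bar ell (fun i => eta_ i w)) ^+ 2)%:E =
    \int[flip_law eta]_x \sum_i (block_energy i x)%:E)%E.
  rewrite ge0_integral_distribution; first last.
  - move=> x; apply: sume_ge0 => i _.
    by rewrite lee_fin; case/andP: (block_energy_itv i x).
  - apply: emeasurable_sum => i; apply/measurable_EFinP.
    exact: measurable_block_energy.
  by apply: eq_integral => w _ /=; rewrite sqr_enorm_eta_bar sumEFin.
rewrite ge0_integral_sum //; first last.
- by move=> i x _; rewrite lee_fin; case/andP: (block_energy_itv i x).
- by move=> i; apply/measurable_EFinP; exact: measurable_block_energy.
by under eq_bigr do rewrite integral_block_energy; rewrite sumEFin.
Qed.

Hypotheses (delta_gt0 : 0 < delta) (delta_lt_half : delta < 1 / 2)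
  (k_delta : k%:R * delta <= 1).

(** 1 / (1 - delta) <= exp(delta / (1 - delta)), and (k - 1) delta <= 1 - delta. *)
Lemma no_flip_probability_ge : 1 / 4 <= (1 - delta) ^+ k.-1.
Proof.
have d1 : 0 < 1 - delta by move: delta_lt_half; lra.
have h : (1 - delta)^-1 <= expR (delta / (1 - delta)).
  apply: le_trans (expR_ge1Dx _).
  by rewrite le_eqVlt; apply/orP; left; apply/eqP; field; rewrite gt_eqF.
rewrite div1r -[leRHS]invrK lef_pV2 ?posrE ?invr_gt0 ?exprn_gt0 // -exprVn.
apply: (@le_trans _ _ (expR 1)); last exact: expR1_le4.
apply: (@le_trans _ _ (expR (delta / (1 - delta)) ^+ k.-1)).
  by rewrite lerXn2r ?nnegrE ?expR_ge0 // invr_ge0 ltW.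
rewrite -expRM_natr ler_expR mulrAC ler_pdivrMr // mul1r.
have : k%:R = k.-1%:R + 1 :> R by rewrite natr1 prednK.
by move: k_delta => + kE; rewrite kE; lra.
Qed.

(** Without a flip inside the block the block mean is 1 or -1. *)
Lemma mean_energy_ge i : 1 / 4 <= mean_energy i.
Proof.
pose B (m : 'I_n) : set R :=
  if (m %/ k == i)%N && (m %% k != 0)%N then [set 1] else setT.
have mB m : measurable (B m) by rewrite /B; case: ifP => // _; exact: measurable_set1.
rewrite -lee_fin -integral_block_energy.
apply: (@le_trans _ _ (\int[flip_law eta]_x (\1_(box B) x)%:E)%E); last first.
  apply: ge0_le_integral => //.
  - by apply/measurable_EFinP; apply: measurable_indic; exact: measurable_box.
  - by apply/measurable_EFinP; exact: measurable_block_energy.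
  - move=> x _; rewrite lee_fin indicE; have [xB|_] := boolP (x \in box B); last first.
      by case/andP: (block_energy_itv i x).
    rewrite /block_energy (@block_mean_const _ _ _ n_gt0 ell_n _ _ 1) ?expr1n ?minxx //.
    move=> j /eqP ji; rewrite /block_path big1 // => m /and3P[/eqP mj mk _].
    by move: xB; rewrite inE => /(_ m); rewrite /B mj ji eqxx mk.
rewrite integral_indic ?setIT //; last exact: measurable_box.
change ((1 / 4)%:E <= P [set w | forall i, B i (tnth (flips eta w) i)])%E.
rewrite (flips_box chain n_gt0 mB) lee_fin.
have E m : \sum_(b : bool) (`[< B m ((-1) ^+ b) >]%:R * flip_mass delta m b) =
    if (m %/ k == i)%N && (m %% k != 0)%N then 1 - delta else 1.
  rewrite /B; case: ifP => [/andP[_ mk]|_]; last first.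
    apply: (eq_trans _ (flip_mass_total delta m)); apply: eq_bigr => b _.
    by rewrite asboolT // mul1r.
  rewrite big_bool asboolF; last by rewrite /= expr1 => h; lra.
  rewrite asboolT //= mul0r add0r mul1r.
  rewrite /flip_mass; case: eqP => // m0.
  by move: mk; rewrite m0 mod0n.
rewrite (eq_bigr _ (fun m _ => E m)) -big_mkcond /= prodr_const.
apply: (le_trans no_flip_probability_ge).
apply: ler_wiXn2l; [by move: delta_lt_half; lra|by move: delta_gt0; lra|].
exact: card_block_interior.
Qed.

Lemma mean_sq_eta_bar_itv :
  ell%:R / 4 <= mean_sq_eta_bar P ell eta_ <= ell%:R.
Proof.
rewrite mean_sq_eta_barE; apply/andP; split.
  rewrite -[X in X%:R / _]card_ord -mulr_natl mulr1 -[X in X / _]sumr_const.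
  rewrite mulr_suml; apply: ler_sum => i _; exact: mean_energy_ge.
rewrite -[X in _ <= X%:R]card_ord -sumr_const; apply: ler_sum => i _.
by case/andP: (mean_energy_itv i).
Qed.

Lemma eta_bar_concentration (d : nat) : (0 < d)%N -> (d <= ell)%N ->
  (P [set w | (5 * Num.sqrt (d%:R * ell%:R) <=
     `|enorm (eta_bar ell (fun i => eta_ i w)) ^+ 2 -
       mean_sq_eta_bar P ell eta_|)%R] <= (2 * expR (- d%:R))%:E)%E.
Proof.
move=> d0 dl.
have mD i : measurable_fun [set: n.-tuple R] (fun x => block_energy i x - mean_energy i).
  by apply: measurable_funB => //; exact: measurable_block_energy.
have := @bernstein_blocks _ _ _ n (flip_law eta) (flip_law_product chain n_gt0)
  ell d (block_of n_gt0 ell_n) (fun i x => block_energy i x - mean_energy i)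
  1 4 5 d0 dl ltr01 mD.
move=> /(_ _ _)/wrap[].
- by move=> i x y xy; rewrite (block_energy_depends xy).
- move=> i lam lam1.
  apply: (mgf_centered_bounded (mD i)) => //.
    move=> x; rewrite ler_norml.
    have /andP[a1 a2] := block_energy_itv i x.
    have /andP[b1 b2] := mean_energy_itv i.
    by apply/andP; split; lra.
  have ib : (flip_law eta).-integrable setT (EFin \o block_energy i).
    apply/integrableP; split.
      by apply/measurable_EFinP; exact: measurable_block_energy.
    under eq_integral => x _.
      rewrite /= ger0_norm; last by case/andP: (block_energy_itv i x).
      over.
    by rewrite integral_block_energy ltry.
  under eq_integral do rewrite EFinB.
  rewrite integralB //; last exact/finite_measure_integrable_cst.
  rewrite integral_block_energy.
  rewrite (_ : (\int[flip_law eta]_x (mean_energy i)%:E = (mean_energy i)%:E)%E).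
    by rewrite -EFinB subrr.
  rewrite integral_cst //; apply: (eq_trans _ (mule1 _)); congr (_ * _)%E.
  exact: probability_setT.
move=> h; apply: le_trans (le_trans h _); last first.
  by rewrite lee_fin ler_wpM2l // ler_expR; lra.
rewrite le_eqVlt; apply/orP; left; apply/eqP; congr (P _).
by apply/seteqP; split => w /=; rewrite sumrB -mean_sq_eta_barE sqr_enorm_eta_bar.
Qed.

End ChainBlocks.

(** * Sub-Gaussian noise *)

Section ScalarMoments.
Context {R : realType} {dT : measure_display} {T : measurableType dT}.
Variable P : probability T R.

Lemma integrable_mul_of_sqr (f g : T -> R) :
  measurable_fun setT f -> measurable_fun setT g ->
  P.-integrable setT (fun w => (f w ^+ 2)%:E) ->
  P.-integrable setT (fun w => (g w ^+ 2)%:E) ->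
  P.-integrable setT (fun w => (f w * g w)%:E).
Proof.
move=> mf mg if2 ig2.
apply: (@le_integrable _ _ _ _ _ measurableT _
  (fun w => (f w ^+ 2)%:E + (g w ^+ 2)%:E)%E) => //.
- by apply/measurable_EFinP; exact: measurable_funM.
- move=> w _; rewrite -EFinD !abse_EFin lee_fin.
  rewrite [leRHS]ger0_norm ?addr_ge0 ?sqr_ge0 // ler_norml.
  have := sqr_ge0 (f w - g w); have := sqr_ge0 (f w + g w).
  rewrite sqrrB sqrrD => h1 h2; have := sqr_ge0 (f w); have := sqr_ge0 (g w).
  by move=> h3 h4; apply/andP; split; lra.
- exact: integrableD.
Qed.

Lemma integrable_of_sqr (f : T -> R) :
  measurable_fun setT f -> P.-integrable setT (fun w => (f w ^+ 2)%:E) ->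
  P.-integrable setT (EFin \o f).
Proof.
move=> mf if2.
have i1 : P.-integrable setT (fun w : T => ((cst 1 w : R) ^+ 2)%:E).
  by under eq_fun do rewrite expr1n; exact/finite_measure_integrable_cst.
have := integrable_mul_of_sqr mf _ if2 i1.
under [X in _.-integrable _ X]eq_fun do rewrite /= mulr1.
exact.
Qed.

Lemma integrable_sqr_of_finite (f : T -> R) (m : R) :
  measurable_fun setT f -> (\int[P]_w (f w ^+ 2)%:E = m%:E)%E ->
  P.-integrable setT (fun w => (f w ^+ 2)%:E).
Proof.
move=> mf E; apply/integrableP; split.
  by apply/measurable_EFinP; exact: measurable_funX.
by under eq_integral do rewrite abse_EFin ger0_norm ?sqr_ge0 //; rewrite E ltry.
Qed.

(** From 1 + tau E Z <= E exp(tau Z) <= exp(tau^2 s / 2) for small tau of both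
    signs. *)
Lemma subgaussian_mean0 (Z : T -> R) (s : R) :
  measurable_fun setT Z -> P.-integrable setT (EFin \o Z) ->
  (forall tau, \int[P]_w (expR (tau * Z w))%:E <= (expR (tau ^+ 2 * s / 2))%:E)%E ->
  (\int[P]_w (Z w)%:E = 0)%E.
Proof.
move=> mZ iZ sub.
have [m mE] : exists m : R, (\int[P]_w (Z w)%:E = m%:E)%E.
  exists (fine (\int[P]_w (Z w)%:E)%E); rewrite fineK //.
  exact: integrable_fin_num.
pose s' : R := `|s| + 1.
have s1 : 1 <= s' by rewrite lerDr.
have ss : s <= s' by rewrite (le_trans (ler_norm _)) // lerDl.
have low tau : 1 + tau * m <= expR (tau ^+ 2 * s' / 2).
  have iZt : P.-integrable setT (fun w => tau%:E * (Z w)%:E)%E.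
    exact: integrableZl.
  have i1 : P.-integrable setT (EFin \o cst (1 : R)).
    exact/finite_measure_integrable_cst.
  rewrite -lee_fin; apply: (@le_trans _ _ (\int[P]_w (expR (tau * Z w))%:E)%E).
    apply: (@le_trans _ _ (\int[P]_w (1%:E + tau%:E * (Z w)%:E))%E).
      by rewrite integralD // integralZl // mE [X in (_ <= X + _)%E]integral_one.
    apply: le_integral => //.
    - exact: integrableD.
    - apply/integrableP; split.
        by apply/measurable_EFinP; apply: measurableT_comp => //; exact: measurable_funM.
      under eq_integral do rewrite abse_EFin ger0_norm ?expR_ge0 //.
      by apply: (le_lt_trans (sub tau)); rewrite ltry.
    - by move=> w _; rewrite -EFinM -EFinD lee_fin expR_ge1Dx.
  apply: (le_trans (sub tau)); rewrite lee_fin ler_expR.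
  by rewrite ler_pM2r // ler_wpM2l ?sqr_ge0.
have small (y : R) : 0 <= y -> y <= 1 -> expR y <= 1 + 5 * y.
  move=> y0 y1; apply: (le_trans (expR_le_quadratic _)); rewrite ger0_norm //.
  have : y ^+ 2 * expR y <= y * 4.
    apply: ler_pM; rewrite ?sqr_ge0 ?expR_ge0 //.
      by rewrite expr2 ler_piMr.
    by apply: le_trans expR1_le4; rewrite ler_expR.
  lra.
have s'0 : 0 < s' by lra.
have half (e : R) : `|e| = 1 -> e * m <= 0.
  move=> e1; rewrite leNgt; apply/negP => em0.
  pose t := Num.min 1 (e * m / 5) / s'.
  have t0 : 0 < t by rewrite divr_gt0 // lt_min ltr01 divr_gt0.
  have ts : t * s' = Num.min 1 (e * m / 5) by rewrite mulfVK ?gt_eqF.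
  have ts1 : t * s' <= 1 by rewrite ts ge_min lexx.
  have tsm : t * s' <= e * m / 5 by rewrite ts ge_min lexx orbT.
  have t1 : t <= 1 by apply: le_trans ts1; rewrite ler_peMr // ltW.
  have e2 : e ^+ 2 = 1 by rewrite -real_normK ?num_real // e1 expr1n.
  have := low (t * e); rewrite exprMn e2 mulr1 => h.
  have tt : t ^+ 2 * s' <= t * (e * m / 5).
    by rewrite expr2 -mulrA ler_wpM2l // ltW.
  have tt1 : t ^+ 2 * s' <= 1.
    by rewrite expr2 -mulrA mulr_ile1 // ?(ltW t0) // mulr_ge0 // ltW.
  have := small (t ^+ 2 * s' / 2).
  move=> /(_ _ _)/wrap[]; [by rewrite divr_ge0 // mulr_ge0 ?sqr_ge0 // ltW|lra|].
  have : 0 < t * (e * m) by rewrite mulr_gt0.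
  lra.
rewrite mE; congr (_%:E); apply/eqP; rewrite eq_le; apply/andP; split.
  by have := half 1 (normr1 _); rewrite mul1r.
have : `|-1 : R| = 1 by rewrite normrN normr1.
by move=> /half; rewrite mulN1r oppr_le0.
Qed.

End ScalarMoments.

Section NoiseConcentration.
Context {R : realType} {n d : nat}.
Variable mu : probability (n.-tuple (d.-tuple R)) R.

Definition noise_dot (u : 'cV[R]_d) (j : 'I_n) (x : n.-tuple (d.-tuple R)) : R :=
  edot u (col_of_tuple (tnth x j)).

Lemma measurable_noise_dot u j :
  measurable_fun [set: n.-tuple (d.-tuple R)] (noise_dot u j).
Proof.
rewrite /noise_dot /edot; apply: measurable_sum => a; apply: measurable_funM => //.
under eq_fun do rewrite mxE.
exact: (measurableT_comp (measurable_tnth a) (measurable_tnth j)).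
Qed.

Hypothesis mu_prod : product_law mu.
Hypothesis mu_sub : forall j u,
  (\int[mu]_x (expR (noise_dot u j x))%:E <= (expR (enorm u ^+ 2 / 2))%:E)%E.
Hypothesis mu_iso : forall j u,
  (\int[mu]_x (noise_dot u j x ^+ 2)%:E = (enorm u ^+ 2)%:E)%E.

Lemma noise_dot_depends u j : depends_on_coords [pred l | l == j] (noise_dot u j).
Proof. by move=> x y xy; rewrite /noise_dot xy /=. Qed.

Lemma noise_dotZ a u j x : noise_dot (a *: u) j x = a * noise_dot u j x.
Proof. exact: edotZl. Qed.

Lemma noise_dot_mean0 u j : (\int[mu]_x (noise_dot u j x)%:E = 0)%E.
Proof.
apply: (@subgaussian_mean0 _ _ _ mu _ (enorm u ^+ 2)).
- exact: measurable_noise_dot.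
- apply: integrable_of_sqr; first exact: measurable_noise_dot.
  exact: integrable_sqr_of_finite (measurable_noise_dot _ _) (mu_iso j u).
- move=> tau; under eq_integral do rewrite -noise_dotZ.
  apply: (le_trans (mu_sub _ _)); rewrite enormZ exprMn.
  by rewrite real_normK ?num_real.
Qed.

Definition noise_sum (a : 'I_n -> R) u x : R := \sum_j a j * noise_dot u j x.

Lemma measurable_noise_sum a u :
  measurable_fun [set: n.-tuple (d.-tuple R)] (noise_sum a u).
Proof.
apply: measurable_sum => j; apply: measurable_funM => //.
exact: measurable_noise_dot.
Qed.

Lemma noise_sum_mgf a u tau :
  (\int[mu]_x (expR (tau * noise_sum a u x))%:E <=
   (expR (tau ^+ 2 * (\sum_j a j ^+ 2) * enorm u ^+ 2 / 2))%:E)%E.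
Proof.
under eq_integral do rewrite /noise_sum mulr_sumr expR_sum.
rewrite (@integral_prod_blocks _ _ _ _ _ mu_prod _ id _
    (fun j x => expR (tau * (a j * noise_dot u j x)))) ?index_enum_uniq //; first last.
- by move=> j x y xy; rewrite (noise_dot_depends u xy).
- move=> j; apply: measurableT_comp => //; do 2 apply: measurable_funM => //.
  exact: measurable_noise_dot.
apply: (@le_trans _ _ (\prod_j (expR ((tau * a j) ^+ 2 * enorm u ^+ 2 / 2))%:E)%E).
  suff: (0 <= \prod_j \int[mu]_x (expR (tau * (a j * noise_dot u j x)))%:E <=
     \prod_j (expR ((tau * a j) ^+ 2 * enorm u ^+ 2 / 2))%:E)%E by case/andP.
  elim/big_ind2: _ => [|x y z t /andP[x0 xy] /andP[z0 zt]|j _].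
  - by rewrite lee01 lexx.
  - by rewrite mule_ge0 // lee_pmul.
  - apply/andP; split.
      by apply: integral_ge0 => x _; rewrite lee_fin expR_ge0.
    under eq_integral do rewrite mulrA -noise_dotZ.
    apply: (le_trans (mu_sub _ _)); rewrite enormZ exprMn.
    by rewrite real_normK ?num_real.
rewrite prodEFin lee_fin -expR_sum ler_expR le_eqVlt; apply/orP; left; apply/eqP.
by rewrite mulr_sumr !mulr_suml; apply: eq_bigr => j _; rewrite exprMn.
Qed.

Lemma integrable_noise_dot_mul u j l :
  mu.-integrable setT (fun x => (noise_dot u j x * noise_dot u l x)%:E).
Proof.
by apply: integrable_mul_of_sqr; try exact: measurable_noise_dot;
  exact: integrable_sqr_of_finite (measurable_noise_dot _ _) (mu_iso _ _).
Qed.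

(** The noise is centred, so the off-diagonal terms vanish by independence. *)
Lemma noise_sum_second_moment a u :
  (\int[mu]_x (noise_sum a u x ^+ 2)%:E =
   ((\sum_j a j ^+ 2) * enorm u ^+ 2)%:E)%E.
Proof.
have sqE x : ((noise_sum a u x ^+ 2)%:E =
    \sum_j \sum_l (a j * a l)%:E * (noise_dot u j x * noise_dot u l x)%:E)%E.
  rewrite expr2 /noise_sum mulr_suml -sumEFin; apply: eq_bigr => j _.
  rewrite mulr_sumr -sumEFin; apply: eq_bigr => l _.
  by rewrite -EFinM mulrACA.
under eq_integral do rewrite sqE.
have ijl j l : mu.-integrable setT
    (fun x => (a j * a l)%:E * (noise_dot u j x * noise_dot u l x)%:E)%E.
  by apply: integrableZl => //; exact: integrable_noise_dot_mul.
rewrite integral_sum //; last first.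
  by move=> j; apply: integrable_sum.
rewrite mulr_suml -sumEFin; apply: eq_bigr => j _.
rewrite integral_sum // (bigD1 j) //= big1 ?adde0; last first.
  move=> l lj; rewrite integralZl //; last exact: integrable_noise_dot_mul.
  rewrite (@integral_indep_mul_eq0 _ _ _ _ _ mu_prod [pred i | i == j]) ?mule0 //.
  - exact: measurable_noise_dot.
  - exact: measurable_noise_dot.
  - exact: noise_dot_depends.
  - move=> x y xy; apply: noise_dot_depends => i /= /eqP ->.
    by apply: xy => /=.
  - exact: integrable_noise_dot_mul.
  - apply: integrable_of_sqr; first exact: measurable_noise_dot.
    exact: integrable_sqr_of_finite (measurable_noise_dot _ _) (mu_iso _ _).
  - exact: noise_dot_mean0.
rewrite integralZl //; last exact: integrable_noise_dot_mul.
by under eq_integral do rewrite -expr2; rewrite mu_iso -EFinM -expr2.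
Qed.

(** The rate 19 d leaves exp(-d) after a union over the exp(18 d) points of
    the net; 19 = 20 - 1 is the gain of the deviation minus the cost of the
    exponential moment. *)
Lemma noise_sum_tail a u (V : R) : (0 < d)%N -> 0 < V ->
  \sum_j a j ^+ 2 <= V -> enorm u <= 1 ->
  (mu [set x | (20 * Num.sqrt (d%:R * V) <= `|noise_sum a u x|)%R] <=
   (2 * expR (- (19 * d%:R)))%:E)%E.
Proof.
move=> d0 V0 aV u1.
have dR0 : 0 < d%:R :> R by rewrite ltr0n.
pose q : R := Num.sqrt (d%:R / V).
have q0 : 0 < q by rewrite sqrtr_gt0 divr_gt0.
have q2 : q ^+ 2 = d%:R / V by rewrite sqr_sqrtr // divr_ge0 // ltW.
have qs : q * Num.sqrt (d%:R * V) = d%:R.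
  rewrite /q -sqrtrM ?divr_ge0 ?(ltW V0) // mulrACA -expr2.
  by rewrite mulVf ?gt_eqF // mulr1 sqrtr_sqr ger0_norm.
have mgf tau : `|tau| = q ->
    (\int[mu]_x (expR (tau * noise_sum a u x))%:E <= (expR d%:R)%:E)%E.
  move=> tq; apply: (le_trans (noise_sum_mgf _ _ _)); rewrite lee_fin ler_expR.
  rewrite -real_normK ?num_real // tq q2.
  have S0 : 0 <= \sum_j a j ^+ 2 by apply: sumr_ge0 => j _; rewrite sqr_ge0.
  have h1 : d%:R / V * \sum_j a j ^+ 2 <= d%:R.
    by rewrite mulrAC ler_pdivrMr // ler_wpM2l.
  have h2 : enorm u ^+ 2 <= 1 by rewrite expr_le1 ?enorm_ge0.
  have : d%:R / V * (\sum_j a j ^+ 2) * enorm u ^+ 2 <= d%:R * 1.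
    by apply: ler_pM; rewrite ?sqr_ge0 ?mulr_ge0 ?invr_ge0 // ltW.
  lra.
apply: (le_trans (@two_sided_exponential _ _ _ mu (noise_sum a u) q _ _
  (measurable_noise_sum _ _) q0 (mgf _ _) (mgf _ _))).
- by rewrite gtr0_norm.
- by rewrite normrN gtr0_norm.
rewrite lee_fin ler_wpM2l // -expRD ler_expR mulrCA qs; lra.
Qed.

Variable ell : nat.
Hypotheses (n_gt0 : (0 < n)%N) (ell_n : (ell %| n)%N).

Definition block_noise u (i : 'I_ell) x : R := block_mean (fun j => noise_dot u j x) i.

Let k := (n %/ ell)%N.
Let k_gt0 : (0 < k)%N := block_length_gt0 n_gt0 ell_n.
Let rk : R := Num.sqrt k%:R.
Let rk_gt0 : 0 < rk. Proof. by rewrite sqrtr_gt0 ltr0n. Qed.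
Let rk2 : rk ^+ 2 = k%:R. Proof. by rewrite sqr_sqrtr. Qed.

Definition block_weight (i : 'I_ell) (j : 'I_n) : R :=
  if (j %/ k == i)%N then rk^-1 else 0.

Lemma block_noiseE u i x : rk * block_noise u i x = noise_sum (block_weight i) u x.
Proof.
rewrite /block_noise /block_mean mulrA -rk2 expr2 invfM mulrA mulfV ?gt_eqF //.
rewrite mul1r mulr_sumr big_mkcond /=; apply: eq_bigr => j _.
by rewrite /block_weight; case: ifP => // _; rewrite mul0r.
Qed.

Lemma sum_block_weight_sqr i : \sum_j block_weight i j ^+ 2 = 1.
Proof.
transitivity (\sum_(j < n | (j %/ k == i)%N) (k%:R^-1 : R)).
  rewrite [RHS]big_mkcond /=; apply: eq_bigr => j _.
  by rewrite /block_weight; case: ifP => _; rewrite ?expr0n // exprVn rk2.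
by rewrite sum_block_const // mulVf // pnatr_eq0 -lt0n.
Qed.

(** Each noise block mean times sqrt k is a sub-Gaussian variable of variance
    |u|^2; the constants satisfy 216 / 8 - 512 / 8^2 = 19. *)
Lemma noise_quadratic_tail u : (0 < d)%N -> (d <= ell)%N -> enorm u <= 1 ->
  (mu [set x | (216 * Num.sqrt (d%:R * ell%:R) <=
     `|\sum_i ((rk * block_noise u i x) ^+ 2 - enorm u ^+ 2)|)%R] <=
   (2 * expR (- (19 * d%:R)))%:E)%E.
Proof.
move=> d0 dl u1.
have mZ i : measurable_fun [set: n.-tuple (d.-tuple R)]
    (fun x => rk * block_noise u i x).
  by under eq_fun do rewrite block_noiseE; exact: measurable_noise_sum.
have EZ i : (\int[mu]_x ((rk * block_noise u i x) ^+ 2)%:E = (enorm u ^+ 2)%:E)%E.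
  under eq_integral do rewrite block_noiseE.
  by rewrite noise_sum_second_moment sum_block_weight_sqr mul1r.
have := @bernstein_blocks _ _ _ n mu mu_prod ell d (block_of n_gt0 ell_n)
  (fun i x => (rk * block_noise u i x) ^+ 2 - enorm u ^+ 2) (1 / 8) 512 216 d0 dl.
move=> /(_ _ _ _ _)/wrap[].
- by rewrite divr_gt0.
- by move=> i; apply: measurable_funB => //; exact: measurable_funX.
- move=> i x y xy; rewrite /block_noise /block_mean.
  congr ((_ * (_ * _)) ^+ 2 - _); apply: eq_bigr => j ji.
  by apply: noise_dot_depends => l /= /eqP ->; apply: xy; rewrite /= -val_eqE.
- move=> i lam lam8; apply: mgf_subgaussian_square => //.
    move=> tau; under eq_integral do rewrite block_noiseE.
    apply: (le_trans (noise_sum_mgf _ _ _)); rewrite lee_fin ler_expR.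
    rewrite sum_block_weight_sqr mulr1 ler_pM2r // -[leRHS]mulr1 ler_wpM2l ?sqr_ge0 //.
    by rewrite expr_le1 ?enorm_ge0.
  exact: integrable_sqr_of_finite (mZ i) (EZ i).
move=> h; apply: (le_trans h); rewrite lee_fin ler_wpM2l // ler_expR; lra.
Qed.

End NoiseConcentration.

Section NoiseLaw.
Context {R : realType} {dT : measure_display} {T : measurableType dT}.
Variable P : probability T R.
Variables (n d : nat) (xi : {RV P >-> n.-tuple (d.-tuple R)}).

Let xiv (i : 'I_n) (w : T) := col_of_tuple (tnth (xi w) i).

Let measurable_coord i a : measurable_fun setT (fun w => xiv i w a 0).
Proof.
under eq_fun do rewrite mxE.
apply: (measurableT_comp (measurable_tnth a)).
by apply: (measurableT_comp (measurable_tnth i)).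
Qed.

Lemma noise_law_subgaussian : (forall i, subgaussian1 P (xiv i)) ->
  forall j u, (\int[distribution P xi]_x (expR (noise_dot u j x))%:E <=
    (expR (enorm u ^+ 2 / 2))%:E)%E.
Proof.
move=> sub j u; rewrite ge0_integral_distribution //.
  by have := sub j u; rewrite unlock.
by apply/measurable_EFinP; apply: measurableT_comp => //; exact: measurable_noise_dot.
Qed.

(** Expand the square along the coordinates of u. *)
Lemma noise_law_isotropic : (forall i, isotropic P (xiv i)) ->
  forall j u, (\int[distribution P xi]_x (noise_dot u j x ^+ 2)%:E =
    (enorm u ^+ 2)%:E)%E.
Proof.
move=> iso j u; rewrite ge0_integral_distribution //; first last.
- by move=> x; rewrite lee_fin sqr_ge0.
- by apply/measurable_EFinP; apply: measurable_funX; exact: measurable_noise_dot.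
have cov a b : (\int[P]_w (xiv j w a 0 * xiv j w b 0)%:E = (a == b)%:R%:E)%E.
  have := iso j a b; rewrite unlock mxE => <-; apply: eq_integral => w _.
  by congr (_%:E); rewrite [RHS]mxE big_ord1 [X in _ = _ * X]mxE.
have isq a : P.-integrable setT (fun w => (xiv j w a 0 ^+ 2)%:E).
  apply: (@integrable_sqr_of_finite _ _ _ _ _ 1) => //.
  by under eq_integral do rewrite expr2; rewrite cov eqxx.
have iab a b : P.-integrable setT
    (fun w => (u a 0 * u b 0)%:E * (xiv j w a 0 * xiv j w b 0)%:E)%E.
  by apply: integrableZl => //; exact: integrable_mul_of_sqr.
transitivity (\int[P]_w \sum_a \sum_b
    (u a 0 * u b 0)%:E * (xiv j w a 0 * xiv j w b 0)%:E)%E.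
  apply: eq_integral => w _; rewrite /= /noise_dot /edot expr2 mulr_suml -sumEFin.
  apply: eq_bigr => a _; rewrite mulr_sumr -sumEFin; apply: eq_bigr => b _.
  by rewrite -EFinM mulrACA.
rewrite integral_sum //; last by move=> a; exact: integrable_sum.
rewrite sqr_enorm /edot -sumEFin; apply: eq_bigr => a _.
rewrite integral_sum // (bigD1 a) //= big1 ?adde0; last first.
  move=> b /negbTE ba; rewrite integralZl //; last exact: integrable_mul_of_sqr.
  by rewrite cov eq_sym ba mule0.
by rewrite integralZl ?cov ?eqxx ?mule1 //; exact: integrable_mul_of_sqr.
Qed.

Variable eta : {RV P >-> n.-tuple R}.

Lemma measurable_cross_sum (a : n.-tuple R -> 'I_n -> R) (u : 'cV[R]_d) :
  (forall j, measurable_fun [set: n.-tuple R] (fun y => a y j)) ->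
  measurable_fun setT (fun w => noise_sum (a (eta w)) u (xi w)).
Proof.
move=> ma; apply: measurable_sum => j; apply: measurable_funM.
  exact: (measurableT_comp (ma j)).
by apply: measurableT_comp => //; exact: measurable_noise_dot.
Qed.

(** Condition on the finitely many values of eta: as xi is independent of eta,
    the weights become constants. *)
Lemma cross_tail (a : n.-tuple R -> 'I_n -> R) (u : 'cV[R]_d) (V : R) :
  mutually_independent P (fun i w => tnth (xi w) i) ->
  (forall i, subgaussian1 P (xiv i)) ->
  independent P xi eta ->
  (forall i w, tnth (eta w) i = 1 \/ tnth (eta w) i = -1) ->
  (forall j, measurable_fun [set: n.-tuple R] (fun y => a y j)) ->
  (0 < d)%N -> 0 < V -> enorm u <= 1 ->
  (forall y : n.-tuple R, (forall i, tnth y i = 1 \/ tnth y i = -1) ->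
     \sum_j a y j ^+ 2 <= V) ->
  (P [set w | (20 * Num.sqrt (d%:R * V) <=
     `|noise_sum (a (eta w)) u (xi w)|)%R] <= (2 * expR (- (19 * d%:R)))%:E)%E.
Proof.
move=> indep sub indepXE pm ma d0 V0 u1 aV.
set p : R := 2 * expR _.
pose sgn (s : {ffun 'I_n -> bool}) : n.-tuple R := [tuple (-1) ^+ s i | i < n].
have sgn_pm s i : tnth (sgn s) i = 1 \/ tnth (sgn s) i = -1.
  by rewrite tnth_mktuple; case: (s i); [right|left].
pose F s := [set w | eta w = sgn s].
have msgn s : measurable [set sgn s].
  rewrite (_ : [set sgn s] = box (fun i => [set tnth (sgn s) i])).
    by apply: measurable_box => i; exact: measurable_set1.
  apply/seteqP; split => [y -> //|y h]; apply: eq_from_tnth => i; exact: h.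
have mF s : measurable (F s).
  by rewrite -[X in measurable X]setTI; exact: (measurable_funP eta _ _ (msgn s)).
have sgn_inj s s' : sgn s = sgn s' -> s = s'.
  move=> e; apply/ffunP => i; have := congr1 (fun y => tnth y i) e.
  rewrite !tnth_mktuple; case: (s i); case: (s' i) => //= h; exfalso; move: h;
  rewrite ?expr0 ?expr1; lra.
have Finj s s' w : F s w -> F s' w -> s = s'.
  by rewrite /F /= => -> /sgn_inj.
have Fcov w : exists s, F s w.
  exists [ffun i => tnth (eta w) i == -1]; apply: eq_from_tnth => i.
  rewrite tnth_mktuple ffunE; have [->|->] := pm i w.
    by rewrite (_ : (1 == -1 :> R) = false) //; apply/negbTE/eqP; lra.
  by rewrite eqxx.
pose G s := [set x | (20 * Num.sqrt (d%:R * V) <= `|noise_sum (a (sgn s)) u x|)%R].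
have mG s : measurable (G s).
  by apply: measurable_superlevel; apply: measurableT_comp => //; exact: measurable_noise_sum.
rewrite (@measure_finite_partition _ _ _ P _ _ F) //; last first.
  apply: measurable_superlevel; apply: measurableT_comp => //.
  exact: measurable_cross_sum.
have one : (\sum_s P (F s) = 1)%E.
  rewrite -[RHS](@probability_setT _ _ _ P).
  rewrite (@measure_finite_partition _ _ _ P _ setT F) //.
  by apply: eq_bigr => s _; rewrite setTI.
apply: (@le_trans _ _ (\sum_s p%:E * P (F s))%E); last first.
  by rewrite -ge0_sume_distrr // one mule1.
apply: lee_sum => s _.
apply: (@le_trans _ _ (P (xi @^-1` G s `&` eta @^-1` [set sgn s]))).
  rewrite le_eqVlt; apply/orP; left; apply/eqP; congr (P _).
  by apply/seteqP; split => w /= [h1 h2]; split => //; move: h1; rewrite /= h2.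
rewrite indepXE //; apply: lee_wpmul2r => //.
apply: (@noise_sum_tail _ _ _ (distribution P xi)) => //.
- exact: noise_law_subgaussian.
- by apply: aV.
Qed.

End NoiseLaw.

(** * The number of buckets and the rates *)

Section BucketNumber.
Context {R : realType}.
Variables (n d : nat) (delta : R) (theta : 'cV[R]_d).
Hypothesis d_le_n : (d <= n)%N.

Let x : R := n%:R * Num.max delta (enorm theta ^+ 2).
Let ell := ell_star n delta theta.

Let x_ge0 : 0 <= x.
Proof. by rewrite mulr_ge0 // le_max sqr_ge0 orbT. Qed.

Let ceil_bounds : x <= (absz (Num.ceil x))%:R < x + 1.
Proof.
have c0 : 0 <= Num.ceil x by rewrite ceil_ge0; apply: lt_le_trans x_ge0; rewrite ltrN10.
have -> : (absz (Num.ceil x))%:R = (Num.ceil x)%:~R :> R.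
  by rewrite -[in RHS](gez0_abs c0).
rewrite ceil_ge /=; have := ceilB1_lt x.
by rewrite intrB ltrBlDr.
Qed.

Lemma ell_star_ge_d : (d <= ell)%N. Proof. exact: leq_maxl. Qed.

Lemma ell_star_le_n : (ell <= n)%N.
Proof. by rewrite geq_max d_le_n geq_minr. Qed.

Lemma ell_star_ge : Num.min x n%:R <= ell%:R.
Proof.
apply: (@le_trans _ _ (minn (absz (Num.ceil x)) n)%:R); last first.
  by rewrite ler_nat leq_maxr.
have /andP[h _] := ceil_bounds.
by case: leqP => _; rewrite ge_min ?h ?lexx ?orbT.
Qed.

Lemma ell_star_le : ell%:R <= Num.max d%:R (x + 1).
Proof.
rewrite /ell /ell_star -/x; have /andP[_ h] := ceil_bounds.
rewrite le_max; case: (leqP d (minn (absz (Num.ceil x)) n)) => _.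
  apply/orP; right; apply: le_trans (ltW h).
  by rewrite ler_nat geq_minl.
by rewrite lexx.
Qed.

End BucketNumber.

Section Rates.
Context {R : realType}.

Lemma sqrt_le_of_sqr (a b : R) : 0 <= b -> a <= b ^+ 2 -> Num.sqrt a <= b.
Proof.
move=> b0 ab; rewrite -[leRHS]ger0_norm // -sqrtr_sqr; exact: ler_wsqrtr.
Qed.

Lemma local_rate_le_minimax_rate (n d : nat) (delta : R) (theta : 'cV[R]_d) :
  local_rate n delta theta <= minimax_rate n d delta.
Proof.
rewrite /local_rate /minimax_rate; set p := Num.sqrt _; set q := d%:R / n%:R.
have p0 : 0 <= p by exact: sqrtr_ge0.
have q0 : 0 <= q by rewrite divr_ge0.
case: ifPn => // h1; case: ifPn => _; last by rewrite lerDr.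
move: h1; rewrite -ltNge gt_max => /andP[pt _].
have t0 : 0 < enorm theta ^+ 2 by apply: le_lt_trans pt.
rewrite ler_pdivrMr //; apply: (@le_trans _ _ (p * enorm theta ^+ 2)); last first.
  by rewrite ler_wpM2r ?sqr_ge0 // lerDl.
have [pos|neg] := leP 0 (delta * d%:R / n%:R); last first.
  by apply: (le_trans (ltW neg)); rewrite mulr_ge0 ?sqr_ge0.
by rewrite -[leLHS]sqr_sqrtr // -/p expr2 ler_wpM2l // ltW.
Qed.

(** The three summands of eta0 are the deviation of the signal energy, the
    signal-noise cross term and the pure noise; the choice of ell makes the
    first and the last of the order required by each regime. In terms of
    q = d / n and p = sqrt(delta q) the rates are p + q, p^2 / t^2 and q. For
    t^2 <= p + q one gets eta0 <= 453 p + 689 q, and 4 + 16 * 689 = 11028; in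
    the other regimes eta0 is at most 5 + 40 + 2 * 216 <= 480 times p,
    resp. t sqrt q. *)
Lemma rate_of_quadratic_error (n d : nat) (delta : R) (theta : 'cV[R]_d)
    (dev eta0 L2 K g : R) :
  let ell := ell_star n delta theta in
  let t := enorm theta in
  (0 < d)%N -> (d <= n)%N -> 0 < delta -> delta < 1 / 2 ->
  0 <= dev -> dev <= 1 -> dev <= 5 * Num.sqrt (d%:R / ell%:R) ->
  (ell = n -> dev = 0) ->
  eta0 = dev * t ^+ 2 + 40 * t * Num.sqrt (d%:R / n%:R) +
         216 * (Num.sqrt (d%:R * ell%:R) / n%:R) ->
  L2 <= 4 * t ^+ 2 + 16 * eta0 ->
  (0 < t -> L2 <= 1280 * eta0 ^+ 2 / t ^+ 2) ->
  11028 <= K -> 480 <= g -> 1280 * g ^+ 2 <= K ->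
  L2 <= K * local_rate n delta theta.
Proof.
move=> ell t d0 dn dl0 dl1 dev0 dev1 devl devn eta0E L2a L2b.
have D1 : 1 <= d%:R :> R by rewrite ler1n.
have DN : d%:R <= n%:R :> R by rewrite ler_nat.
have lD : d%:R <= ell%:R :> R by rewrite ler_nat ell_star_ge_d.
have lN : ell%:R <= n%:R :> R by rewrite ler_nat ell_star_le_n.
have lge := ell_star_ge n delta theta; rewrite -/ell -/t in lge.
have lle := ell_star_le n delta theta; rewrite -/ell -/t in lle.
set D : R := d%:R in D1 DN lD lle eta0E devl *.
set N : R := n%:R in DN lN lge lle eta0E *.
set l : R := ell%:R in lD lN lge lle devl eta0E *.
have D0 : 0 < D by lra.
have N0 : 0 < N by lra.
have l0 : 0 < l by lra.
have t0 : 0 <= t by exact: enorm_ge0.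
pose q := D / N; pose r := Num.sqrt q; pose p := Num.sqrt (delta * D / N).
have q0 : 0 < q by rewrite divr_gt0.
have qN : D = q * N by rewrite /q mulfVK // gt_eqF.
have r0 : 0 <= r by exact: sqrtr_ge0.
have r2 : r ^+ 2 = q by rewrite sqr_sqrtr // ltW.
have p0 : 0 <= p by exact: sqrtr_ge0.
have p2 : p ^+ 2 = delta * q.
  by rewrite sqr_sqrtr ?mulrA // divr_ge0 ?(ltW N0) // mulr_ge0 ?(ltW D0) ?(ltW dl0).
have lNdelta : N * delta <= l.
  apply: le_trans lge; rewrite le_min; apply/andP; split.
    by rewrite ler_pM2l // le_max lexx.
  by rewrite -[leRHS]mulr1 ler_pM2l //; lra.
have noise b : 0 <= b -> q * (l / N) <= b ^+ 2 -> Num.sqrt (D * l) / N <= b.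
  move=> b0 h; rewrite ler_pdivrMr //; apply: sqrt_le_of_sqr.
    by rewrite mulr_ge0 // ltW.
  rewrite qN exprMn.
  have -> : q * N * l = q * (l / N) * N ^+ 2 by field; rewrite gt_eqF.
  by rewrite ler_wpM2r ?sqr_ge0.
have deviation c b : 0 < c -> N * c <= l -> 0 <= b -> t ^+ 2 ^+ 2 * (q / c) <= b ^+ 2 ->
    dev * t ^+ 2 <= 5 * b.
  move=> c0 cl b0 h.
  apply: (@le_trans _ _ (5 * Num.sqrt (D / l) * t ^+ 2)).
    by rewrite ler_wpM2r ?sqr_ge0.
  rewrite -mulrA ler_pM2l // -[t ^+ 2]ger0_norm ?sqr_ge0 // -sqrtr_sqr.
  rewrite -sqrtrM ?divr_ge0 ?(ltW D0) ?(ltW l0) //.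
  apply: sqrt_le_of_sqr => //; apply: le_trans h.
  rewrite mulrC ler_wpM2l ?sqr_ge0 // ler_pdivrMr // qN.
  have -> : q / c * l = q * (l / c) by field; rewrite gt_eqF.
  by rewrite ler_pM2l // ler_pdivlMr.
have rt_mul b : 0 <= b -> t ^+ 2 * q <= b ^+ 2 -> t * r <= b.
  move=> b0 h; rewrite -(@ler_pXn2r _ 2) ?nnegrE ?mulr_ge0 //.
  by rewrite exprMn r2.
rewrite /local_rate -/D -/N -/q -/p -/t.
(* Small signal: t^2 <= p + q. *)
case: ifPn => [c1|]; last rewrite -ltNge gt_max => /andP[pt qt] _ g480 K2.
  have c1' : t ^+ 2 <= p + q.
    by apply: (le_trans c1); rewrite ge_max lerDl lerDr p0 ltW.
  have nz : Num.sqrt (D * l) / N <= 2 * q + p + t ^+ 2.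
    have b0 : 0 <= 2 * q + p + t ^+ 2 by have := sqr_ge0 t; lra.
    apply: noise => //.
    have lN2 : l / N <= 2 * q + delta + t ^+ 2.
      rewrite ler_pdivrMr // !mulrDl -mulrA -qN.
      apply: (le_trans lle); rewrite ge_max; apply/andP; split.
        have : 0 <= delta * N by rewrite mulr_ge0 ?ltW.
        have : 0 <= t ^+ 2 * N by rewrite mulr_ge0 ?sqr_ge0 ?ltW.
        lra.
      have : N * Num.max delta (t ^+ 2) <= delta * N + t ^+ 2 * N.
        rewrite -mulrDl mulrC ler_pM2r // ge_max lerDl lerDr sqr_ge0 /=.
        exact: ltW.
      lra.
    apply: (@le_trans _ _ (q * (2 * q + delta + t ^+ 2))).
      by rewrite ler_pM2l.
    have -> : q * (2 * q + delta + t ^+ 2) = 2 * q ^+ 2 + p ^+ 2 + q * t ^+ 2.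
      by rewrite p2; ring.
    have h1 : 0 <= q * p by rewrite mulr_ge0 // ltW.
    have h2 : 0 <= q * t ^+ 2 by rewrite mulr_ge0 ?sqr_ge0 // ltW.
    have h3 : 0 <= p * t ^+ 2 by rewrite mulr_ge0 ?sqr_ge0.
    have h4 := sqr_ge0 (t ^+ 2); have h5 := sqr_ge0 q.
    have -> : (2 * q + p + t ^+ 2) ^+ 2 = 4 * q ^+ 2 + p ^+ 2 + t ^+ 2 ^+ 2 +
       4 * (q * p) + 4 * (q * t ^+ 2) + 2 * (p * t ^+ 2) by ring.
    lra.
  have tr : t * r <= (t ^+ 2 + q) / 2.
    have := sqr_ge0 (t - r); rewrite sqrrB r2; lra.
  have dv : dev * t ^+ 2 <= t ^+ 2 by rewrite -[leRHS]mul1r ler_wpM2r ?sqr_ge0.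
  have L2le : L2 <= 11028 * (p + q).
    apply: (le_trans L2a); rewrite eta0E -/q -/r -mulrA; lra.
  move=> K1 _ _; apply: (le_trans L2le); apply: ler_wpM2r K1.
  by rewrite addr_ge0 // ltW.
have t2 : 0 < t ^+ 2 by apply: lt_trans qt.
have tp : 0 < t by rewrite lt0r t0 andbT; apply: contraTneq t2 => ->; rewrite expr0n ltxx.
have squares b : 0 <= b -> 0 <= eta0 -> eta0 <= 480 * b ->
    L2 <= K * (b ^+ 2 / t ^+ 2).
  move=> b0 e0 eb; apply: (le_trans (L2b tp)).
  rewrite [leRHS]mulrA ler_pM2r ?invr_gt0 //.
  have g0 : 0 <= g by exact: le_trans (ler0n R 480) g480.
  have ebc : eta0 <= g * b by apply: (le_trans eb); rewrite ler_wpM2r.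
  apply: (@le_trans _ _ (1280 * (g * b) ^+ 2)).
    apply: (ler_wpM2l (ler0n R 1280)).
    by rewrite ler_pXn2r ?nnegrE // mulr_ge0.
  by rewrite exprMn mulrA; apply: ler_wpM2r K2; rewrite sqr_ge0.
clear g480 K2.
have e0 : 0 <= eta0.
  rewrite eta0E !addr_ge0 ?mulr_ge0 ?sqr_ge0 ?invr_ge0 ?sqrtr_ge0 // ltW //.
have split_eta b : dev * t ^+ 2 <= 5 * b -> t * r <= b ->
    Num.sqrt (D * l) / N <= 2 * b -> eta0 <= 480 * b.
  move=> h1 h2 h3; have h4 : 0 <= t * r by rewrite mulr_ge0.
  rewrite eta0E -/q -/r -mulrA; lra.
(* Here delta >= t^2 > q, so n delta > d >= 1 and ell <= 2 n delta. *)
case: ifPn => [c2|].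
  have tdelta : t ^+ 2 <= delta by move: c2; rewrite le_max [X in _ || X]leNgt qt orbF.
  have maxE : Num.max delta (t ^+ 2) = delta by rewrite max_l.
  have -> : delta * D / N = p ^+ 2 by rewrite p2 /q mulrA.
  apply: squares => //; apply: split_eta.
  - apply: (deviation delta) => //.
    have -> : p ^+ 2 = delta ^+ 2 * (q / delta) by rewrite p2; field; rewrite gt_eqF.
    apply: ler_wpM2r; first by rewrite divr_ge0 ?(ltW q0) ?(ltW dl0).
    by rewrite ler_pXn2r ?nnegrE ?sqr_ge0 ?(ltW dl0).
  - by apply: rt_mul => //; rewrite p2 ler_wpM2r ?(ltW q0).
  - apply: noise; first by rewrite mulr_ge0.
    have -> : (2 * p) ^+ 2 = q * (4 * delta) by rewrite exprMn p2; ring.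
    rewrite ler_pM2l // ler_pdivrMr //.
    have qd : q * N <= delta * N by rewrite ler_pM2r //; lra.
    rewrite -qN in qd.
    apply: (le_trans lle); rewrite maxE ge_max; apply/andP; split; lra.
(* Here t^2 > delta, and ell is of order n t^2 unless t >= 1, where ell = n. *)
rewrite -ltNge gt_max => /andP[dt _].
have maxE : Num.max delta (t ^+ 2) = t ^+ 2 by rewrite max_r // ltW.
have -> : q = (t * r) ^+ 2 / t ^+ 2.
  by rewrite exprMn r2 mulrAC mulfV ?mul1r ?gt_eqF.
have tr0 : 0 <= t * r by rewrite mulr_ge0.
apply: squares => //; apply: split_eta => //.
  have [big|small] := leP N (N * t ^+ 2).
    have -> : dev = 0.
      apply: devn; apply/eqP; rewrite eqn_leq (ell_star_le_n delta theta dn) /=.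
      by rewrite -(ler_nat R); move: lge; rewrite maxE min_r.
    by rewrite mul0r mulr_ge0.
  apply: (deviation (t ^+ 2)) => //.
    by move: lge; rewrite maxE min_l // ltW.
  have -> : (t * r) ^+ 2 = t ^+ 2 ^+ 2 * (q / t ^+ 2).
    by rewrite exprMn r2; field; rewrite gt_eqF.
  exact: lexx.
apply: noise; first by rewrite mulr_ge0.
have -> : (2 * (t * r)) ^+ 2 = q * (4 * t ^+ 2) by rewrite !exprMn r2; ring.
rewrite ler_pM2l // ler_pdivrMr //.
have [big|small] := leP N (N * t ^+ 2).
  apply: (le_trans lN); lra.
have qd : q * N <= t ^+ 2 * N by rewrite ler_pM2r //; lra.
rewrite -qN in qd.
apply: (le_trans lle); rewrite maxE ge_max; apply/andP; split; lra.
Qed.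

End Rates.

(** * The risk bound on the good event and its probability *)

Section ErrorDecomposition.
Context {R : realType}.
Variables (n d ell : nat).
Hypotheses (n_gt0 : (0 < n)%N) (ell_n : (ell %| n)%N).
Variables (theta : 'cV[R]_d) (y : 'I_n -> R) (z : n.-tuple (d.-tuple R)).

Let k := (n %/ ell)%N.
Let rk : R := Num.sqrt k%:R.
Let Y j := y j *: theta + col_of_tuple (tnth z j).
Let S := enorm (eta_bar ell y) ^+ 2.

Let kR_gt0 : 0 < k%:R :> R.
Proof. by rewrite ltr0n block_length_gt0. Qed.
Let ell_gt0 : 0 < ell%:R :> R.
Proof. by rewrite ltr0n (dvdn_gt0 n_gt0). Qed.
Let nE : n%:R = ell%:R * k%:R :> R.
Proof. by rewrite -natrM mulnC divnK. Qed.

(** The weight of the j-th noise vector in the sum of eta_i xi_i over the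
    blocks. *)
Definition cross_weight (j : 'I_n) : R :=
  block_mean y (block_of n_gt0 ell_n j) / k%:R.

Lemma sum_over_blocks (f : 'I_ell -> 'I_n -> R) :
  \sum_j f (block_of n_gt0 ell_n j) j =
  \sum_(i < ell) \sum_(j < n | (j %/ k == i)%N) f i j.
Proof.
rewrite (partition_big (block_of n_gt0 ell_n) xpredT) //=; apply: eq_bigr => i _.
apply: eq_big => [j|j /eqP <-] //.
Qed.

Lemma sum_cross_weight_sqr : \sum_j cross_weight j ^+ 2 = S / k%:R.
Proof.
rewrite /cross_weight (sum_over_blocks (fun i j => (block_mean y i / k%:R) ^+ 2)).
rewrite /S sqr_enorm /edot mulr_suml; apply: eq_bigr => i _.
rewrite (sum_block_const n_gt0 ell_n) mxE; field; exact: lt0r_neq0.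
Qed.

Lemma Ytilde_dot u i :
  ((Ytilde ell Y)^T *m u) i 0 =
  block_mean y i * edot u theta + block_noise u i z.
Proof.
rewrite mxE (eq_bigr (fun a => k%:R^-1 *
    \sum_(j < n | (j %/ k == i)%N) Y j a 0 * u a 0)); last first.
  by move=> a _; rewrite !mxE /block_mean -mulrA mulr_suml.
rewrite -mulr_sumr exchange_big /= /block_noise /block_mean -mulrA -mulrDr.
congr (_ * _); rewrite mulr_suml -big_split /=; apply: eq_bigr => j _.
rewrite /noise_dot /edot mulr_sumr -big_split /=; apply: eq_bigr => a _.
by rewrite !mxE; ring.
Qed.

(** Centred when s is the mean of |eta_bar|^2 / ell. *)
Definition signal_noise_error (s : R) : 'M[R]_d :=
  Sigma_hat ell Y - (k%:R^-1)%:M - s *: (theta *m theta^T).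

Lemma Sigma_hat_sym : (Sigma_hat ell Y)^T = Sigma_hat ell Y.
Proof. by rewrite /Sigma_hat linearZ /= trmx_mul trmxK. Qed.

Lemma signal_noise_error_sym s : (signal_noise_error s)^T = signal_noise_error s.
Proof.
rewrite /signal_noise_error !linearB /= Sigma_hat_sym tr_scalar_mx.
by rewrite linearZ /= trmx_mul trmxK.
Qed.

Lemma signal_noise_error_bilinear s x x' :
  edot x (signal_noise_error s *m x') =
  edot x ((Sigma_hat ell Y - (k%:R^-1)%:M) *m x') - s * edot x theta * edot theta x'.
Proof.
rewrite /signal_noise_error mulmxBl edotDr edotNr; congr (_ - _).
rewrite -scalemxAl edotZr -mulrA; congr (_ * _).
have -> : theta *m theta^T *m x' = edot theta x' *: theta.
  rewrite -mulmxA [theta^T *m x']mx11_scalar -edotE.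
  by rewrite mul_mx_scalar.
by rewrite edotZr mulrC.
Qed.

(** Expand the square of <u, Y_i> = eta_i <u, theta> + <u, xi_i>, where Y_i,
    eta_i and xi_i are block means, and average over the blocks. *)
Lemma signal_noise_error_quadratic s u :
  edot u (signal_noise_error s *m u) =
  (S / ell%:R - s) * edot u theta ^+ 2 +
  2 * edot u theta * (noise_sum cross_weight u z / ell%:R) +
  (\sum_(i < ell) ((rk * block_noise u i z) ^+ 2 - enorm u ^+ 2)) / n%:R.
Proof.
rewrite signal_noise_error_bilinear mulmxBl edotDr edotNr mul_scalar_mx edotZr.
rewrite /Sigma_hat -scalemxAl edotZr -mulmxA -[in edot u (_ *m (_ *m u))](trmxK (Ytilde ell Y)).
rewrite edotC edot_trmul trmxK.
have cross : noise_sum cross_weight u z =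
    \sum_(i < ell) block_mean y i * block_noise u i z.
  rewrite /noise_sum /cross_weight.
  rewrite (sum_over_blocks (fun i j => block_mean y i / k%:R * noise_dot u j z)).
  apply: eq_bigr => i _; rewrite /block_noise /block_mean -mulr_sumr -/k.
  by rewrite !mulrA.
have sq : edot ((Ytilde ell Y)^T *m u) ((Ytilde ell Y)^T *m u) =
    S * edot u theta ^+ 2 + 2 * edot u theta * noise_sum cross_weight u z +
    \sum_(i < ell) block_noise u i z ^+ 2.
  rewrite cross /S sqr_enorm /edot -/(edot u theta) mulr_suml mulr_sumr -!big_split /=.
  apply: eq_bigr => i _; rewrite Ytilde_dot !mxE; ring.
rewrite sq sumrB.
have -> : \sum_(i < ell) (rk * block_noise u i z) ^+ 2 =
    k%:R * \sum_(i < ell) block_noise u i z ^+ 2.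
  by rewrite mulr_sumr; apply: eq_bigr => i _; rewrite exprMn sqr_sqrtr // ltW.
rewrite sumr_const card_ord -[_ *+ ell]mulr_natr -sqr_enorm nE (edotC theta u).
by field; rewrite !gt_eqF.
Qed.

End ErrorDecomposition.

Section GoodEvent.
Context {R : realType}.
Variables (n d : nat) (delta : R) (theta : 'cV[R]_d).
Variables (y : 'I_n -> R) (z : n.-tuple (d.-tuple R)) (E2 : R).
Variable vmax : 'M[R]_d -> 'cV[R]_d.

Let ell := ell_star n delta theta.
Let k := (n %/ ell)%N.
Let rk : R := Num.sqrt k%:R.
Let Y j := y j *: theta + col_of_tuple (tnth z j).
Let S := enorm (eta_bar ell y) ^+ 2.

Hypotheses (d_gt0 : (0 < d)%N) (d_le_n : (d <= n)%N).
Hypotheses (delta_gt0 : 0 < delta) (delta_lt_half : delta < 1 / 2).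
Hypothesis ell_n : (ell %| n)%N.
Let n_gt0 : (0 < n)%N := leq_trans d_gt0 d_le_n.

Hypothesis vmaxP : top_eigenvector_choice vmax.
Hypothesis y_pm : forall i, y i = 1 \/ y i = -1.
Hypothesis E2_itv : ell%:R / 4 <= E2 <= ell%:R.
(* Blocks of length 1 have energy 1: the signal energy does not fluctuate. *)
Hypothesis E2_trivial : ell = n -> E2 = ell%:R.
Hypothesis good_energy : `|S - E2| <= 5 * Num.sqrt (d%:R * ell%:R).
Hypothesis good_cross : forall c : lattice_code d, in_net (R := R) c ->
  `|noise_sum (cross_weight n_gt0 ell_n y) (lattice_point c) z| <=
  20 * Num.sqrt (d%:R * (ell%:R / k%:R)).
Hypothesis good_noise : forall c : lattice_code d, in_net (R := R) c ->
  `|\sum_(i < ell) ((rk * block_noise (lattice_point c) i z) ^+ 2 -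
                    enorm (lattice_point c : 'cV[R]_d) ^+ 2)| <=
  216 * Num.sqrt (d%:R * ell%:R).

(** On the net the quadratic form of the error is at most eta0, hence its
    operator norm is at most 2 eta0; together with s >= 1/4 this gives the
    constants 4, 16 and 20 * 8^2 = 1280 required of the loss. *)
Lemma loss_on_good_event (K g : R) :
  11028 <= K -> 480 <= g -> 1280 * g ^+ 2 <= K ->
  loss (theta_hat ell E2 vmax Y) theta ^+ 2 <= K * local_rate n delta theta.
Proof.
have l0 : 0 < ell%:R :> R by rewrite ltr0n (dvdn_gt0 n_gt0).
have N0 : 0 < n%:R :> R by rewrite ltr0n.
have D0 : 0 < d%:R :> R by rewrite ltr0n.
have k0 : 0 < k%:R :> R by rewrite ltr0n block_length_gt0.
have nE : n%:R = ell%:R * k%:R :> R by rewrite -natrM mulnC divnK.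
have /andP[E2l E2u] := E2_itv.
have SE : S = \sum_(i < ell) block_mean y i ^+ 2.
  by rewrite /S sqr_enorm; apply: eq_bigr => i _; rewrite !mxE -expr2.
have S_itv : 0 <= S <= ell%:R.
  rewrite SE; apply/andP; split; first by apply: sumr_ge0 => i _; rewrite sqr_ge0.
  rewrite -[X in _ <= X%:R]card_ord -sumr_const; apply: ler_sum => i _.
  apply: block_mean_sqr_le1 => // j.
  by have [->|->] := y_pm j; rewrite ?normrN normr1.
have /andP[S0 S1] := S_itv.
have S_trivial : ell = n -> S = ell%:R.
  move=> elln; rewrite SE.
  transitivity (\sum_(i < ell) (1 : R)); last by rewrite sumr_const card_ord.
  apply: eq_bigr => i _.
  have kE : (n %/ ell)%N = 1%N by rewrite elln divnn n_gt0.
  have iN : (i < n)%N by rewrite -elln.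
  rewrite (@block_mean_const _ _ _ n_gt0 ell_n _ _ (y (Ordinal iN))); last first.
    move=> j; rewrite kE divn1 => /eqP ji; congr y; exact: val_inj.
  by have [->|->] := y_pm (Ordinal iN); rewrite ?sqrrN expr1n.
pose s := E2 / ell%:R.
have s_ge : 1 / 4 <= s by rewrite ler_pdivlMr // mulrC mulrA mulr1.
have s0 : 0 < s by lra.
pose dev := `|S / ell%:R - s|.
have devE : dev = `|S - E2| / ell%:R.
  by rewrite /dev /s -mulrBl normrM normfV (gtr0_norm l0).
pose t := enorm theta.
have t0 : 0 <= t := enorm_ge0 theta.
pose eta0 := dev * t ^+ 2 + 40 * t * Num.sqrt (d%:R / n%:R) +
  216 * (Num.sqrt (d%:R * ell%:R) / n%:R).
pose E := signal_noise_error ell theta y z s.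
have net_error c : in_net (R := R) c ->
    `|edot (lattice_point c) (E *m lattice_point c)| <= eta0.
  move=> cnet; set u : 'cV[R]_d := lattice_point c.
  have u1 : enorm u <= 1 by [].
  have ut : `|edot u theta| <= t.
    by apply: (le_trans (cauchy_schwarz _ _)); rewrite ler_piMl.
  rewrite /E (signal_noise_error_quadratic n_gt0 ell_n).
  apply: (le_trans (ler_normD _ _)); apply: lerD.
    apply: (le_trans (ler_normD _ _)); apply: lerD.
      rewrite normrM -/S -/dev ler_wpM2l ?normr_ge0 //.
      by rewrite normrX ler_pXn2r ?nnegrE ?normr_ge0.
    rewrite !normrM normfV (gtr0_norm l0) (@ger0_norm _ 2) //.
    apply: (@le_trans _ _ (2 * t * (20 * Num.sqrt (d%:R * (ell%:R / k%:R)) / ell%:R))).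
      apply: ler_pM; rewrite ?mulr_ge0 ?invr_ge0 ?normr_ge0 ?(ltW l0) //.
        by rewrite ler_pM2l.
      by rewrite ler_pM2r ?invr_gt0 //; exact: good_cross.
    have -> : Num.sqrt (d%:R * (ell%:R / k%:R)) = ell%:R * Num.sqrt (d%:R / n%:R) :> R.
      rewrite -{2}[ell%:R]gtr0_norm // -sqrtr_sqr -sqrtrM ?sqr_ge0 //; congr Num.sqrt.
      by rewrite nE; field; rewrite !gt_eqF.
    by rewrite le_eqVlt; apply/orP; left; apply/eqP; field; rewrite gt_eqF.
  rewrite normrM normfV (gtr0_norm N0) mulrA ler_pM2r ?invr_gt0 //.
  exact: good_noise.
have bilin := net_bound d_gt0 (signal_noise_error_sym ell theta y z s) net_error.
pose lam := lambda_max (Sigma_hat ell Y) - k%:R^-1.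
pose M := Sigma_hat ell Y - (k%:R^-1)%:M.
have symS : (Sigma_hat ell Y)^T = Sigma_hat ell Y by exact: Sigma_hat_sym.
have [vE v1] := vmaxP symS.
have Mv : M *m vmax (Sigma_hat ell Y) = lam *: vmax (Sigma_hat ell Y).
  by rewrite mulmxBl vE mul_scalar_mx -scalerBl.
have ray x : edot x (M *m x) <= lam * enorm x ^+ 2.
  rewrite mulmxBl edotDr edotNr mul_scalar_mx edotZr mulrBl -sqr_enorm lerD2r.
  exact: rayleigh_le_lambda_max.
have spike x x' : `|edot x (M *m x') - s * edot x theta * edot theta x'| <=
    2 * eta0 * enorm x * enorm x'.
  by rewrite -signal_noise_error_bilinear; exact: bilin.
have hatE : theta_hat ell E2 vmax Y =
    Num.sqrt (Num.max lam 0 / s) *: vmax (Sigma_hat ell Y).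
  by rewrite /theta_hat /s invf_div mulrC.
rewrite hatE.
have eta0_ge0 : 0 <= eta0.
  rewrite /eta0; apply: addr_ge0; first apply: addr_ge0.
  - by rewrite mulr_ge0 ?normr_ge0 ?sqr_ge0.
  - by rewrite !mulr_ge0 ?sqrtr_ge0.
  - by rewrite mulr_ge0 ?divr_ge0 ?sqrtr_ge0.
have es : 2 * eta0 / s <= 8 * eta0.
  rewrite ler_pdivrMr //; have := ler_wpM2l eta0_ge0 s_ge; lra.
have es0 : 0 <= 2 * eta0 / s.
  by apply: divr_ge0; [exact: mulr_ge0|exact: ltW].
move=> K1 g480 K2.
apply: (@rate_of_quadratic_error _ n d delta theta dev eta0 _ K g _ _ _ _ _ _ _
  _ _ _ _ K1 g480 K2) => {K1 g480 K2} //.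
- exact: normr_ge0.
- rewrite devE ler_pdivrMr // mul1r ler_norml; apply/andP; split; lra.
- rewrite devE ler_pdivrMr //.
  apply: (le_trans good_energy); rewrite -mulrA ler_pM2l //.
  rewrite -[X in _ <= _ * X]gtr0_norm // -sqrtr_sqr -sqrtrM ?divr_ge0 //.
  by rewrite le_eqVlt; apply/orP; left; apply/eqP; congr Num.sqrt; field; rewrite gt_eqF.
- by move=> elln; rewrite devE S_trivial // E2_trivial // subrr normr0 mul0r.
- apply: (le_trans (loss_crude_bound s0 Mv v1 spike)); rewrite -/t; lra.
- move=> tp; apply: (le_trans (loss_gap_bound s0 Mv v1 ray spike tp)).
  rewrite -/t ler_pM2r ?invr_gt0 ?exprn_gt0 //.
  have : (2 * eta0 / s) ^+ 2 <= (8 * eta0) ^+ 2.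
    by rewrite ler_pXn2r ?nnegrE // mulr_ge0.
  rewrite exprMn; lra.
Qed.

End GoodEvent.

Lemma measure_bigsetU_le {R : realType} {dT : measure_display}
    {T : measurableType dT} (P : probability T R) (I : finType) (Q : pred I)
    (B : I -> set T) (p : R) :
  (forall i, Q i -> measurable (B i)) -> (forall i, Q i -> (P (B i) <= p%:E)%E) ->
  measurable (\big[setU/set0]_(i | Q i) B i) /\
  (P (\big[setU/set0]_(i | Q i) B i) <= (\sum_(i | Q i) p)%:E)%E.
Proof.
move=> mB PB; elim/big_rec2: _ => [|i q A Qi [mA PA]].
  by split => //; rewrite measure0.
split; first by apply: measurableU => //; exact: mB.
apply: (le_trans (measureU2 _ _ _)) => //; first exact: mB.
by rewrite EFinD; apply: leeD => //; exact: PB.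
Qed.

Theorem proposition3 (R : realType) :
  exists K c0 c1 : R, [/\ 0 < K, 0 < c0, 0 < c1 &
  forall (n d : nat) (delta : R) (theta : 'cV[R]_d)
    (disp : measure_display) (T : measurableType disp) (P : probability T R)
    (eta : {RV P >-> n.-tuple R}) (xi : {RV P >-> n.-tuple (d.-tuple R)})
    (vmax : 'M[R]_d -> 'cV[R]_d),
  let eta_ := fun (i : 'I_n) (w : T) => tnth (eta w) i in
  let xi_ := fun (i : 'I_n) (w : T) => tnth (xi w) i in
  let xiv := fun (i : 'I_n) (w : T) => col_of_tuple (xi_ i w) in
  let Y := fun (w : T) (i : 'I_n) => eta_ i w *: theta + xiv i w in
  let ell := ell_star n delta theta in
  let that := fun w : T =>
    theta_hat ell (mean_sq_eta_bar P ell eta_) vmax (Y w) in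
  (1 <= d)%N -> (d <= n)%N ->
  0 < delta -> delta < 1 / 2 ->
  symmetric_markov_chain P delta eta_ ->
  mutually_independent P xi_ ->
  identically_distributed P xi_ ->
  (forall i, isotropic P (xiv i)) ->
  (forall i, subgaussian1 P (xiv i)) ->
  independent P xi eta ->
  top_eigenvector_choice vmax ->
  (ell %| n)%N ->
  with_probability_gt P (1 - c1 * expR (- c0 * d%:R))
    [set w | loss (that w) theta ^+ 2 <= K * local_rate n delta theta] /\
  with_probability_gt P (1 - c1 * expR (- c0 * d%:R))
    [set w | loss (that w) theta ^+ 2 <= K * minimax_rate n d delta]].
Proof.
(* Only lower bounds on the constant of the rate are used. *)
have [K [g [K0 Kg]]] : exists K g : R,
    0 < K /\ [/\ 11028 <= K, 480 <= g & 1280 * g ^+ 2 <= K].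
  pose g : R := 480; exists (11028 + 1280 * g ^+ 2), g.
  have gK : 0 <= 1280 * g ^+ 2.
    by apply: mulr_ge0; [exact: (ler0n R 1280)|exact: sqr_ge0].
  split; first by apply: (lt_le_trans (ltr0n R 11028)); rewrite lerDl.
  by split; [rewrite lerDl|exact: lexx|rewrite lerDr (ler0n R 11028)].
exists K, 1, 7; split; [exact: K0|exact: ltr01|exact: (ltr0n R 7)|].
move=> n d delta theta disp T P eta xi vmax eta_ xi_ xiv Y ell that.
move=> d_gt0 d_le_n delta_gt0 delta_lt chain indep _ iso sub indepXE vmaxP ell_n.
have n_gt0 : (0 < n)%N := leq_trans d_gt0 d_le_n.
pose k := (n %/ ell)%N; pose rk : R := Num.sqrt k%:R.
have d_le_ell : (d <= ell)%N := ell_star_ge_d n delta theta.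
have l0 : 0 < ell%:R :> R by rewrite ltr0n (dvdn_gt0 n_gt0).
have k0 : 0 < k%:R :> R by rewrite ltr0n block_length_gt0.
have nE : n%:R = ell%:R * k%:R :> R by rewrite -natrM mulnC divnK.
have N0 : 0 < n%:R :> R by rewrite ltr0n.
have k_delta : k%:R * delta <= 1.
  have : n%:R * delta <= ell%:R.
    apply: le_trans (ell_star_ge n delta theta); rewrite le_min; apply/andP; split.
      by rewrite ler_pM2l // le_max lexx.
    by rewrite -[leRHS]mulr1 ler_pM2l //; lra.
  by rewrite nE -mulrA -[leRHS]mulr1 ler_pM2l.
have eta_pm i w : eta_ i w = 1 \/ eta_ i w = -1 by have [h _ _] := chain; exact: h.
pose E2 := mean_sq_eta_bar P ell eta_.
have E2_itv := mean_sq_eta_bar_itv chain n_gt0 ell_n delta_gt0 delta_lt k_delta.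
have E2_trivial : ell = n -> E2 = ell%:R.
  move=> elln; have S_cst w : enorm (eta_bar ell (fun i => eta_ i w)) ^+ 2 = ell%:R.
    rewrite sqr_enorm /edot.
    transitivity (\sum_(i < ell) (1 : R)); last by rewrite sumr_const card_ord.
    apply: eq_bigr => i _; rewrite !mxE -expr2.
    have kE : (n %/ ell)%N = 1%N by rewrite elln divnn n_gt0.
    have iN : (i < n)%N by rewrite -elln.
    rewrite (@block_mean_const _ _ _ n_gt0 ell_n _ _ (eta_ (Ordinal iN) w)); last first.
      move=> j; rewrite kE divn1 => /eqP ji; congr eta_; exact: val_inj.
    by have [->|->] := eta_pm (Ordinal iN) w; rewrite ?sqrrN expr1n.
  rewrite /E2 /mean_sq_eta_bar unlock.
  under eq_integral do rewrite S_cst -[_%:R]mulr1 EFinM.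
  by rewrite ge0_integralZl // integral_one mule1.
pose weight (x : n.-tuple R) := cross_weight n_gt0 ell_n (fun j => tnth x j).
have mweight j : measurable_fun [set: n.-tuple R] (fun x => weight x j).
  apply: measurable_funM => //; apply: measurable_funM => //.
  under eq_fun do rewrite big_mkcond /=.
  apply: measurable_sum => l; case: (l %/ _ == _)%N => //; exact: measurable_tnth.
have weight_le (x : n.-tuple R) : (forall i, tnth x i = 1 \/ tnth x i = -1) ->
    \sum_j weight x j ^+ 2 <= ell%:R / k%:R.
  move=> xpm; rewrite sum_cross_weight_sqr ler_pM2r ?invr_gt0 //.
  rewrite sqr_enorm -[X in _ <= X%:R]card_ord -sumr_const; apply: ler_sum => i _.
  rewrite !mxE -expr2; apply: block_mean_sqr_le1 => // j.
  by have [->|->] := xpm j; rewrite ?normrN normr1.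
pose B1 := [set w | 5 * Num.sqrt (d%:R * ell%:R) <=
  `|enorm (eta_bar ell (fun i => eta_ i w)) ^+ 2 - E2|].
pose B2 (c : lattice_code d) := [set w | 20 * Num.sqrt (d%:R * (ell%:R / k%:R)) <=
  `|noise_sum (weight (eta w)) (lattice_point c) (xi w)|].
pose B3 (c : lattice_code d) := [set w | 216 * Num.sqrt (d%:R * ell%:R) <=
  `|\sum_(i < ell) ((rk * block_noise (lattice_point c) i (xi w)) ^+ 2 -
                    enorm (lattice_point c : 'cV[R]_d) ^+ 2)|].
have mB1 : measurable B1.
  apply: measurable_superlevel; apply: measurableT_comp => //.
  apply: measurable_funB => //.
  under eq_fun do rewrite (sqr_enorm_eta_bar chain n_gt0 ell_n).
  apply: measurable_sum => i.
  apply: (measurableT_comp (measurable_block_energy i)).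
  exact: measurable_flips.
have mB2 c : measurable (B2 c).
  apply: measurable_superlevel; apply: measurableT_comp => //.
  exact: measurable_cross_sum.
have mB3 c : measurable (B3 c).
  apply: measurable_superlevel; apply: measurableT_comp => //.
  apply: measurable_sum => i; apply: measurable_funB => //; apply: measurable_funX.
  under eq_fun do rewrite (block_noiseE n_gt0 ell_n).
  by apply: measurableT_comp => //; exact: measurable_noise_sum.
have PB1 : (P B1 <= (2 * expR (- d%:R))%:E)%E.
  exact: (eta_bar_concentration chain n_gt0 ell_n).
have PB2 c : in_net (R := R) c -> (P (B2 c) <= (2 * expR (- (19 * d%:R)))%:E)%E.
  move=> cnet; apply: cross_tail => //; exact: divr_gt0.
have PB3 c : in_net (R := R) c -> (P (B3 c) <= (2 * expR (- (19 * d%:R)))%:E)%E.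
  move=> cnet.
  by apply: (@noise_quadratic_tail _ _ _ (distribution P xi) _ _ _ _ n_gt0 ell_n) => //;
    [exact: noise_law_subgaussian|exact: noise_law_isotropic].
pose p : R := 4 * expR (- (19 * d%:R)).
have mB23 c : in_net (R := R) c -> measurable (B2 c `|` B3 c).
  by move=> _; exact: measurableU.
have PB23 c : in_net (R := R) c -> (P (B2 c `|` B3 c) <= p%:E)%E.
  move=> cnet; apply: (le_trans (measureU2 _ _ _)) => //.
  have -> : p = 2 * expR (- (19 * d%:R)) + 2 * expR (- (19 * d%:R)).
    by rewrite /p; lra.
  by rewrite EFinD; apply: leeD; [exact: PB2|exact: PB3].
have [mN PN] := measure_bigsetU_le mB23 PB23.
pose Bad := B1 `|` \big[setU/set0]_(c | in_net (R := R) c) (B2 c `|` B3 c).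
have mBad : measurable Bad by exact: measurableU.
have PBad : (P Bad <= (6 * expR (- d%:R))%:E)%E.
  apply: (le_trans (measureU2 P mB1 mN)).
  have -> : 6 * expR (- d%:R) = 2 * expR (- d%:R) + 4 * expR (- d%:R) :> R by lra.
  rewrite EFinD; apply: leeD => //; apply: (le_trans PN); rewrite lee_fin.
  have -> : - d%:R = 18 * d%:R + - (19 * d%:R) :> R by lra.
  rewrite expRD mulrCA -/p.
  apply: (@le_trans _ _ ((\sum_(c : lattice_code d | in_net (R:=R) c) 1) * p)).
    by rewrite mulr_suml; apply: ler_sum => c _; rewrite mul1r.
  rewrite ler_wpM2r ?mulr_ge0 ?expR_ge0 //; exact: card_net.
have PGood : ((1 - 7 * expR (- (1) * d%:R))%:E < P (~` Bad))%E.
  rewrite probability_setC //.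
  apply: (@lt_le_trans _ _ (1 - (6 * expR (- d%:R))%:E)%E); last exact: leeB.
  rewrite -EFinB lte_fin mulN1r; have := expR_gt0 (- d%:R : R); lra.
have good w : (~` Bad) w -> loss (that w) theta ^+ 2 <= K * local_rate n delta theta.
  move=> nBad; have nB1 : ~ B1 w by move=> h; apply: nBad; left.
  have nB c : in_net (R := R) c -> ~ (B2 c `|` B3 c) w.
    move=> cnet h; apply: nBad; right; rewrite -bigcup_seq_cond.
    by exists c => //=; rewrite mem_index_enum cnet.
  have [K1 g480 K2] := Kg.
  apply: (@loss_on_good_event R n d delta theta (fun i => eta_ i w) (xi w) E2
    vmax d_gt0 d_le_n delta_gt0 delta_lt ell_n vmaxP (eta_pm^~ w) E2_itv
    E2_trivial _ _ _ K g K1 g480 K2) => {K1 g480 K2}.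
  - by rewrite ltW // ltNge; exact/negP.
  - move=> c cnet; rewrite ltW // ltNge; apply/negP => h.
    by apply: (nB c cnet); left.
  - move=> c cnet; rewrite ltW // ltNge; apply/negP => h.
    by apply: (nB c cnet); right.
split; exists (~` Bad); split => //; try exact: measurableC.
move=> w /good h; apply: (le_trans h).
by rewrite ler_wpM2l ?(ltW K0) // local_rate_le_minimax_rate.
Qed.
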